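(* Let $(\Omega,\Sigma,\mu)$ be a non-atomic finite measure space. A closed linear subspace $Z\subset L_1(\Omega,\Sigma,\mu)$ is poor if and only if for every $\Delta\in\Sigma^+$ and for every $\varepsilon>0$ there is $g\in L_\infty(\Omega,\Sigma,\mu)$ with $\|g\|_\infty=1$ such that $g=0$ off $\Delta$ and $\|g\|_{Z^*}<\varepsilon$. Moreover, in the statement above $g$ can be selected non-negative.
   Context: All Banach spaces are real. A Banach space $X$ has the Daugavet property if $\|\mathrm{Id}+T\|=1+\|T\|$ for every rank-one bounded linear operator $T\colon X\to X$. If $X$ has the Daugavet property, a closed linear subspace $Z\subset X$ is poor if $X/\tilde Z$ has the Daugavet property for every closed linear subspace $\tilde Z\subset Z$. $L_1(\Omega,\Sigma,\mu)$ with $\mu$ non-atomic is known to have the Daugavet property. $\Sigma^+=\{A\in\Sigma:\mu(A)>0\}$. For $g\in L_\infty=(L_1)^*$, $\|g\|_{Z^*}=\sup\{|\int g z\,d\mu|: z\in Z,\ \|z\|_1\le 1\}$, i.e. the norm of the restriction of $g$ to $Z$. *)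

(* Defs.v *)
From HB Require Import structures.
From mathcomp Require Import all_boot all_order all_algebra.
From mathcomp Require Import all_classical all_reals all_analysis.
From mathcomp Require Import measurable_realfun ess_sup_inf.

Set Implicit Arguments.
Unset Strict Implicit.
Unset Printing Implicit Defensive.

Import Order.TTheory GRing.Theory Num.Theory.
Import numFieldNormedType.Exports.

Local Open Scope classical_set_scope.
Local Open Scope ring_scope.

(* The library provides LspaceType as a bare quotient type; it is equipped
   below with its vector space structure and with the norm 'N[mu]_p. *)
Section Lspace_normedModType.
Context d (T : measurableType d) (R : realType).
Variables (mu : {measure set T -> \bar R}) (p : \bar R) (p1 : (1 <= p)%E).

Local Notation lf := (LfunType mu p1).
Local Notation L := (LspaceType mu p1).

Lemma Lnorm_ae_eq (f g : T -> R) : measurable_fun setT f ->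
  measurable_fun setT g -> f = g %[ae mu] ->
  'N[mu]_p[EFin \o f]%E = 'N[mu]_p[EFin \o g]%E.
Proof.
move=> mf mg fg; rewrite unlock /Lnorm; case: p p1 => [r r1|_|//].
  have mN (h : T -> R) : measurable_fun setT h ->
      @measurable_fun _ _ T (\bar R) setT
        (fun x => (`|(EFin \o h) x| `^ r)%E).
    move=> mh; apply: (@measurableT_comp _ _ _ _ _ _ (fun y => y `^ r)%E).
      exact: measurable_poweR.
    by apply: measurableT_comp => //; exact/measurable_EFinP.
  congr (_ `^ _)%E; apply: ae_eq_integral; [by []|exact: mN|exact: mN|].
  by apply: filterS fg => x /= fg _; rewrite fg.
case: ifPn => // _; apply: eq_ess_sup.
by apply: filterS fg => x /= ->.
Qed.

Definition Lrepr_mfun (F : L) : {mfun T >-> measurableTypeR R} :=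
  repr (F : {mfun_ mu, T >-> measurableTypeR R}).

Lemma Lrepr_subproof (F : L) : (Lrepr_mfun F : T -> R) \in Lfun mu p.
Proof.
apply/andP; split; rewrite inE/=.
  exact: (@measurable_funPT _ _ _ _ (Lrepr_mfun F)).
exact: (@Lebesgue_finite _ _ _ _ _ p1 F).
Qed.

Definition Lrepr (F : L) : lf := Lfun_Sub p1 (Lrepr_subproof F).

Lemma Lfun_mfun_subproof (f : lf) : (f : T -> measurableTypeR R) \in mfun.
Proof. by rewrite inE; exact: (@measurable_funPT _ _ _ _ f). Qed.

Definition Lfun_mfun (f : lf) : {mfun T >-> measurableTypeR R} :=
  mfun_Sub (Lfun_mfun_subproof f).

Definition Lclass_mfun (f : lf) : {mfun_ mu, T >-> measurableTypeR R} :=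
  \pi_({mfun_ mu, T >-> measurableTypeR R})%qT (Lfun_mfun f).

Lemma Lclass_mfun_ae (f : lf) : (Lclass_mfun f : T -> R) = f %[ae mu].
Proof.
have /eqP := reprK (Lclass_mfun f).
by rewrite /Lclass_mfun eqmodE => /asboolP.
Qed.

Lemma Lclass_subproof (f : lf) : finite_norm mu p (Lclass_mfun f : T -> R).
Proof.
rewrite /finite_norm (_ : 'N[mu]_p[_] = 'N[mu]_p[EFin \o f])%E.
  exact: Lfunction_finite.
apply: Lnorm_ae_eq.
- exact: (@measurable_funPT _ _ _ _ (repr (Lclass_mfun f))).
- exact: measurable_funPT.
- exact: Lclass_mfun_ae.
Qed.

Definition Lclass (f : lf) : L :=
  HB.pack_for L (Lclass_mfun f)
    (isFinLebesgue.Build _ _ _ _ _ p1 (Lclass_mfun f) (Lclass_subproof f)).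

Lemma Lspace_eqP (F G : L) : F = G <-> (F : T -> R) = G %[ae mu].
Proof.
split=> [->|]; first exact: ae_eq_refl.
case: F G => [F [[F1]]] [G [[G1]]] /= FG.
have FGe : F = G.
  rewrite -[F]reprK -[G]reprK; apply/eqP; rewrite eqmodE; exact/asboolP.
move: F1 G1 {FG}; rewrite FGe => F1 G1.
by rewrite (Prop_irrelevance F1 G1).
Qed.

Lemma LclassK (f : lf) : (Lclass f : T -> R) = f %[ae mu].
Proof. exact: Lclass_mfun_ae. Qed.

HB.instance Definition _ := gen_eqMixin L.
HB.instance Definition _ := gen_choiceMixin L.

Definition Ladd (F G : L) : L := Lclass (Lrepr F + Lrepr G).
Definition Lopp (F : L) : L := Lclass (- Lrepr F).
Definition Lscale (a : R) (F : L) : L := Lclass (a *: Lrepr F).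
Definition Lzero : L := Lclass 0.

Lemma LaddE (F G : L) :
  {ae mu, forall x, (Ladd F G : T -> R) x = (F : T -> R) x + (G : T -> R) x}.
Proof. by apply: filterS (LclassK (Lrepr F + Lrepr G)) => x /= ->. Qed.

Lemma LoppE (F : L) :
  {ae mu, forall x, (Lopp F : T -> R) x = - (F : T -> R) x}.
Proof. by apply: filterS (LclassK (- Lrepr F)) => x /= ->. Qed.

Lemma LscaleE (a : R) (F : L) :
  {ae mu, forall x, (Lscale a F : T -> R) x = a * (F : T -> R) x}.
Proof. by apply: filterS (LclassK (a *: Lrepr F)) => x /= ->. Qed.

Lemma LzeroE : {ae mu, forall x, (Lzero : T -> R) x = 0}.
Proof. by apply: filterS (LclassK 0) => x /= ->. Qed.

Lemma Lspace_eq (F G : L) :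
  {ae mu, forall x, (F : T -> R) x = (G : T -> R) x} -> F = G.
Proof. by move=> FG; apply/Lspace_eqP; apply: filterS FG. Qed.

Lemma LaddA : associative Ladd.
Proof.
move=> F G H; apply: Lspace_eq.
near=> x.
rewrite (near (LaddE F (Ladd G H)) x)// (near (LaddE G H) x)//.
by rewrite (near (LaddE (Ladd F G) H) x)// (near (LaddE F G) x)// addrA.
Unshelve. all: by end_near. Qed.

Lemma LaddC : commutative Ladd.
Proof.
move=> F G; apply: Lspace_eq; near=> x.
by rewrite (near (LaddE F G) x)// (near (LaddE G F) x)// addrC.
Unshelve. all: by end_near. Qed.

Lemma Ladd0 : left_id Lzero Ladd.
Proof.
move=> F; apply: Lspace_eq; near=> x.
by rewrite (near (LaddE Lzero F) x)// (near LzeroE x)// add0r.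
Unshelve. all: by end_near. Qed.

Lemma LaddN : left_inverse Lzero Lopp Ladd.
Proof.
move=> F; apply: Lspace_eq; near=> x.
rewrite (near (LaddE (Lopp F) F) x)// (near (LoppE F) x)//.
by rewrite (near LzeroE x)// addNr.
Unshelve. all: by end_near. Qed.

HB.instance Definition _ :=
  GRing.isZmodule.Build L LaddA LaddC Ladd0 LaddN.

Lemma LscaleA (a b : R) (F : L) : Lscale a (Lscale b F) = Lscale (a * b) F.
Proof.
apply: Lspace_eq; near=> x.
rewrite (near (LscaleE a (Lscale b F)) x)// (near (LscaleE b F) x)//.
by rewrite (near (LscaleE (a * b) F) x)// mulrA.
Unshelve. all: by end_near. Qed.

Lemma Lscale1 : left_id 1 Lscale.
Proof.
move=> F; apply: Lspace_eq; near=> x.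
by rewrite (near (LscaleE 1 F) x)// mul1r.
Unshelve. all: by end_near. Qed.

Lemma LscaleDr : right_distributive Lscale +%R.
Proof.
move=> a F G; apply: Lspace_eq; near=> x.
rewrite (near (LscaleE a (F + G)) x)// (near (LaddE F G) x)//.
rewrite (near (LaddE (Lscale a F) (Lscale a G)) x)//.
by rewrite (near (LscaleE a F) x)// (near (LscaleE a G) x)// mulrDr.
Unshelve. all: by end_near. Qed.

Lemma LscaleDl F : {morph Lscale^~ F : a b / a + b}.
Proof.
move=> a b; apply: Lspace_eq; near=> x.
rewrite (near (LscaleE (a + b) F) x)//.
rewrite (near (LaddE (Lscale a F) (Lscale b F)) x)//.
by rewrite (near (LscaleE a F) x)// (near (LscaleE b F) x)// mulrDl.
Unshelve. all: by end_near. Qed.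

HB.instance Definition _ := GRing.Zmodule_isLmodule.Build R L
  LscaleA Lscale1 LscaleDr LscaleDl.

Definition Lspace_norm (F : L) : R :=
  fine ('N[mu]_p[EFin \o (F : T -> R)])%E.

Lemma Lspace_norm_class (f : lf) :
  Lspace_norm (Lclass f) = fine ('N[mu]_p[EFin \o f])%E.
Proof.
congr fine; apply: Lnorm_ae_eq; last exact: LclassK.
- exact: (@measurable_funPT _ _ _ _ (Lrepr (Lclass f))).
- exact: measurable_funPT.
Qed.

Lemma Lspace_normD (F G : L) :
  Lspace_norm (F + G) <= Lspace_norm F + Lspace_norm G.
Proof. by rewrite Lspace_norm_class; exact: ler_LnormD. Qed.

Lemma Lspace_normZ (a : R) (F : L) :
  Lspace_norm (a *: F) = `|a| * Lspace_norm F.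
Proof.
rewrite Lspace_norm_class; apply: EFin_inj.
rewrite EFinM (finite_norm_fine (Lrepr F)) (finite_norm_fine (a *: Lrepr F)).
exact: LnormZ.
Qed.

Lemma Lspace_norm0_eq0 (F : L) : Lspace_norm F = 0 -> F = 0.
Proof.
move=> /(@fine_Lnormr_eq0 _ _ _ _ _ _ (Lrepr F)) F0; apply: Lspace_eq.
by near=> x; rewrite (near LzeroE x)//; near: x; apply: filterS F0 => x; exact.
Unshelve. all: by end_near. Qed.

HB.instance Definition _ := Lmodule_isNormed.Build R L
  Lspace_normD Lspace_normZ Lspace_norm0_eq0.

End Lspace_normedModType.

Record closedSubspace (R : numFieldType) (V : normedModType R) :=
  ClosedSubspace {
    subspace_pred :> {pred V};
    subspace_submod : submod_closed subspace_pred;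
    subspace_closed : closed [set x | x \in subspace_pred]
  }.

HB.instance Definition _ (R : numFieldType) (V : normedModType R)
    (Z : closedSubspace V) :=
  GRing.isZmodClosed.Build V (subspace_pred Z)
    (GRing.submod_closedB (subspace_submod Z)).
HB.instance Definition _ (R : numFieldType) (V : normedModType R)
    (Z : closedSubspace V) :=
  GRing.isScaleClosed.Build R V (subspace_pred Z)
    (GRing.subsemimod_closedZ (GRing.submod_closed_semi (subspace_submod Z))).

(* The quotient V / Z is the library's quotient Z-module, with scalar
   multiplication induced from V and with the norm
   |q| = inf {|x| : x in the coset q} = inf {|x - z| : z in Z}. *)
Section quotient_normedModType.
Context (R : realType) (V : normedModType R) (Z : closedSubspace V).
Local Open Scope quotient_scope.

Definition quotient_space : Type := Quotient.quot (subspace_pred Z).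
Local Notation Q := quotient_space.
HB.instance Definition _ := GRing.Zmodule.on Q.
HB.instance Definition _ := Quotient.on Q.

Lemma quotient_eqP (x y : V) : (\pi_Q x = \pi_Q y) <-> x - y \in Z.
Proof.
rewrite (_ : (x - y \in Z) = (x == y %[mod Q])); last exact: Quotient.idealrBE.
by split=> /eqP.
Qed.

Lemma quotient_piD (x y : V) : \pi_Q (x + y) = \pi_Q x + \pi_Q y.
Proof. exact: (@pi_addr _ _ _ _ _ (Quotient.quot (subspace_pred Z))). Qed.

Lemma quotient_pi0 : \pi_Q 0 = 0.
Proof. exact: (@pi_zeror _ _ _ _ _ (Quotient.quot (subspace_pred Z))). Qed.

Definition quotient_scale (a : R) (q : Q) : Q := \pi_Q (a *: repr q).

Lemma quotient_scale_pi (a : R) (x : V) :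
  quotient_scale a (\pi_Q x) = \pi_Q (a *: x).
Proof.
apply/quotient_eqP; rewrite -scalerBr rpredZ//.
by apply/quotient_eqP; rewrite reprK.
Qed.

Lemma quotient_scaleA (a b : R) (q : Q) :
  quotient_scale a (quotient_scale b q) = quotient_scale (a * b) q.
Proof.
elim/quotW: q => x.
by rewrite (quotient_scale_pi b x) !quotient_scale_pi scalerA.
Qed.

Lemma quotient_scale1 : left_id 1 quotient_scale.
Proof. by elim/quotW => x; rewrite !quotient_scale_pi scale1r. Qed.

Lemma quotient_scaleDr : right_distributive quotient_scale +%R.
Proof.
move=> a; elim/quotW => x; elim/quotW => y; rewrite -quotient_piD !quotient_scale_pi.
by rewrite scalerDr quotient_piD.
Qed.

Lemma quotient_scaleDl q : {morph quotient_scale^~ q : a b / a + b}.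
Proof.
by move=> a b; elim/quotW: q => x; rewrite !quotient_scale_pi scalerDl quotient_piD.
Qed.

HB.instance Definition _ := GRing.Zmodule_isLmodule.Build R Q
  quotient_scaleA quotient_scale1 quotient_scaleDr quotient_scaleDl.

Definition quotient_norm (q : Q) : R :=
  inf [set `|x| | x in [set x : V | \pi_Q x = q]].

Lemma quotient_norm_has_inf (q : Q) :
  has_inf [set `|x| | x in [set x : V | \pi_Q x = q]].
Proof.
split; first by exists `|repr q|, (repr q) => //=; rewrite reprK.
by exists 0 => _ [x _ <-].
Qed.

Lemma quotient_norm_le (x : V) : quotient_norm (\pi_Q x) <= `|x|.
Proof.
by apply: ge_inf; [exact: (quotient_norm_has_inf _).2|exists x].
Qed.

Lemma quotient_norm_ge0 (q : Q) : 0 <= quotient_norm q.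
Proof.
by apply: lb_le_inf; [exact: (quotient_norm_has_inf _).1|move=> _ [x _ <-]].
Qed.

Lemma quotient_norm_adherent (q : Q) (e : R) : 0 < e ->
  exists2 x : V, \pi_Q x = q & `|x| < quotient_norm q + e.
Proof.
by move=> /inf_adherent /(_ (quotient_norm_has_inf q))[_ [x xq <-] ?]; exists x.
Qed.

Lemma quotient_normD (q r : Q) :
  quotient_norm (q + r) <= quotient_norm q + quotient_norm r.
Proof.
apply/ler_addgt0Pr => e e0; have e2 : 0 < e / 2 by rewrite divr_gt0.
have [x <- xq] := quotient_norm_adherent q e2.
have [y <- yr] := quotient_norm_adherent r e2.
rewrite -quotient_piD (le_trans (quotient_norm_le _))//.
rewrite (le_trans (ler_normD _ _))// [X in _ <= _ + X]splitr addrACA.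
by rewrite lerD// ltW.
Qed.

Lemma quotient_normZ_le (a : R) (q : Q) :
  quotient_norm (a *: q) <= `|a| * quotient_norm q.
Proof.
apply/ler_addgt0Pr => e e0.
have a1 : 0 < `|a| + 1 by rewrite ltr_pwDr.
have [x <- xq] := quotient_norm_adherent q (divr_gt0 e0 a1).
rewrite [_ *: _]quotient_scale_pi (le_trans (quotient_norm_le _))//.
rewrite normrZ (@le_trans _ _ (`|a| * (quotient_norm (\pi_Q x) + e / (`|a| + 1))))//.
  by rewrite ler_wpM2l// ltW.
rewrite mulrDr lerD2l mulrCA ger_pMr// ler_pdivrMr// mul1r.
by rewrite lerDl.
Qed.

Lemma quotient_normZ (a : R) (q : Q) :
  quotient_norm (a *: q) = `|a| * quotient_norm q.
Proof.
apply/eqP; rewrite eq_le quotient_normZ_le/=.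
have [->|a0] := eqVneq a 0.
  by rewrite normr0 mul0r quotient_norm_ge0.
have := quotient_normZ_le a^-1 (a *: q).
rewrite scalerA mulVf// scale1r normfV => h.
by rewrite -ler_pdivlMl ?normr_gt0.
Qed.

Lemma quotient_norm0_eq0 (q : Q) : quotient_norm q = 0 -> q = 0.
Proof.
move=> q0; rewrite -quotient_pi0 -[q]reprK; apply/quotient_eqP; rewrite subr0.
suff : closure [set x | x \in Z] (repr q).
  by have /closure_id <- := @subspace_closed _ _ Z.
move=> B /nbhs_ballP[e /= e0 eB].
have [x xq] := quotient_norm_adherent q e0; rewrite q0 add0r => xe.
exists (repr q - x); split.
  by apply/quotient_eqP; rewrite reprK xq.
by apply: eB; rewrite -ball_normE /= opprB addrC subrK.
Qed.

HB.instance Definition _ := Lmodule_isNormed.Build R Q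
  quotient_normD quotient_normZ quotient_norm0_eq0.

End quotient_normedModType.

Section daugavet.
Context (R : realType).

Definition operator_norm (V W : normedModType R) (f : V -> W) : R :=
  sup [set `|f x| | x in [set x : V | `|x| <= 1]].

Definition rank_one (V W : normedModType R) (f : V -> W) : Prop :=
  exists2 y : W, y != 0 & range f = range (fun a : R => a *: y).

Definition Daugavet_property (V : normedModType R) : Prop :=
  forall T : {linear V -> V}, continuous T -> rank_one T ->
    operator_norm (fun x => x + T x) = 1 + operator_norm T.

(* Z' = {0} is allowed, so poorness contains the Daugavet property of V
   itself, up to the isometry V / {0} = V. *)
Definition poor (V : normedModType R) (Z : closedSubspace V) : Prop :=
  forall Z' : closedSubspace V, {subset Z' <= Z} ->
    Daugavet_property (quotient_space Z').

End daugavet.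

Definition nonatomic d (T : measurableType d) (R : realType)
    (mu : {measure set T -> \bar R}) : Prop :=
  forall A, measurable A -> (0 < mu A)%E ->
    exists B, [/\ measurable B, B `<=` A & (0 < mu B < mu A)%E].

(* The elements are classes for equality mu-a.e.; applying one to a point
   evaluates a representative. *)
Notation L1 mu := (LspaceType mu (lexx 1%E)).
Notation Linfty mu := (LspaceType mu (leey 1%E)).

Definition dual_norm d (T : measurableType d) (R : realType)
    (mu : {measure set T -> \bar R}) (Z : closedSubspace (L1 mu))
    (g : Linfty mu) : R :=
  sup [set `| \int[mu]_x ((g : T -> R) x * (z : T -> R) x) |
      | z in [set z : L1 mu | z \in Z /\ `|z| <= 1]].

(* Main.v *)
Require Import Defs.
From HB Require Import structures.
From mathcomp Require Import all_boot all_order all_algebra.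
From mathcomp Require Import all_classical all_reals all_analysis.
From mathcomp Require Import measurable_realfun ess_sup_inf.
From mathcomp Require Import lra ring.

Set Implicit Arguments.
Unset Strict Implicit.
Unset Printing Implicit Defensive.

Import Order.TTheory GRing.Theory Num.Theory.
Import numFieldNormedType.Exports.

Local Open Scope classical_set_scope.
Local Open Scope ring_scope.

(** Integration against bounded functions identifies the dual of [L1] with
    [Linfty] (Radon-Nikodym), so that, by Hahn-Banach, the norm of a class in a
    quotient of [L1] is attained by a function bounded by 1 that annihilates
    the subspace.  Everything below is a construction of such functions.

    Small functions make [Z] poor.  Let [Z'] be a subspace of [Z] and let the
    rank-one operator [q |-> f q *: v] act on [L1 / Z'], with [v] of norm 1;
    [f] is integration against some [a] with essential supremum [N], the norm
    of [f] (up to sign), and [v] is normed by some [h].  On a set [D] of small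
    measure on which [a] is close to [N] and [h] close to a constant [c], take
    [g >= 0] supported in [D], of norm 1 and small on [Z].  Then
    [k = h + (1 - c) g] is still bounded by almost 1, nearly annihilates [Z']
    and nearly norms [v], but it is close to 1 on the set where [g] peaks.  If
    [q] is the class of the normalized indicator of that set, testing against
    [k] shows that [q + f q *: v] has norm close to [1 + N].  This is
    [bump_perturbation].

    Signs can be removed.  If [u >= 0] is at least [t] on [B], and [g] is
    supported in [B], then [u + t g] is still nonnegative and is at least
    [t + t / 2] where [g] (or [- g]) exceeds 1/2, while its action on [Z] has
    hardly changed.  Starting from the indicator of [Delta] one obtains large
    nonnegative functions with bounded action on [Z]; these are normalized.
    This is [nonnegative_growth].

    Poor subspaces admit small functions.  Let [y] be bounded by 1, equal to
    [-1] on [D], and bounded away from 1 in absolute value off [D].  The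
    Daugavet property of [L1 / (Z `&` ker y)], used for the functional [- y]
    and for the class [p] of an element [x1] of [Z] with [y x1 = 1], gives [h]
    bounded by 1, close to 1 on a part of [D], and almost norming [p].  On [Z],
    [h] is a multiple of [y], almost as large as a function bounded by 1
    allows, hence at least almost [y] itself; a convex combination [z] of [h]
    and [- y] then almost agrees with [y] on [Z], although [z] is close to 1
    where [y = -1].  This is [poor_flip].

    The difference [z - y] is small on [Z] but is not supported in [D].  The
    remedy is to choose [y] so that it records what has accumulated off
    [Delta]: given [s] small on [Z] and bounded by 1 off [Delta], let [y] be
    [-1] where [s] is large, and almost [s] off [Delta].  Then [s + (z - y)]
    is almost [z], hence bounded by 1, off [Delta], and on a subset of [Delta]
    where [s] was at least [n] it is at least [n + 1].  After [n] rounds the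
    function is at least [n] somewhere on [Delta] and still bounded by 1
    elsewhere, so that cutting it off outside [Delta] and normalizing costs
    only [O(1 / n)].  This is [poor_staircase]. *)

(** * Bounded functionals and the Hahn-Banach theorem *)

Section scalar_functional.
Context (R : realType) (V : lmodType R).
Implicit Types (f : V -> R) (x y : V).

Lemma functional0 f : scalar f -> f 0 = 0.
Proof.
move=> flin; have := flin 1 0 0; rewrite scaler0 addr0 mul1r.
by move=> /(congr1 (fun a : R => a - f 0)); rewrite addrK subrr.
Qed.

Lemma functionalZ f a x : scalar f -> f (a *: x) = a * f x.
Proof. by move=> flin; have := flin a x 0; rewrite functional0// !addr0. Qed.

Lemma functionalN f x : scalar f -> f (- x) = - f x.
Proof. by move=> flin; rewrite -scaleN1r functionalZ// mulN1r. Qed.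

Lemma functionalD f x y : scalar f -> f (x + y) = f x + f y.
Proof. by move=> flin; have := flin 1 x y; rewrite scale1r mul1r. Qed.

Lemma functionalB f x y : scalar f -> f (x - y) = f x - f y.
Proof. by move=> flin; rewrite functionalD// functionalN. Qed.

End scalar_functional.

Section norming_functional.
Context (R : realType) (V : normedModType R).
Implicit Types (G : set (V * R)) (x y v : V).

(** Graphs of partially defined functionals of norm at most 1.
    Single-valuedness need not be required: it follows from linearity and
    domination. *)
Definition dominated_graph G : Prop :=
  (forall (a : R) x r y s, G (x, r) -> G (y, s) -> G (a *: x + y, a * r + s)) /\
  (forall x r, G (x, r) -> r <= `|x|).

(** The value [c] at a new vector [v] must lie between all [r - |x - v|] and
    all [|x + v| - r]; the triangle inequality makes these bounds compatible.
    *)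
Lemma dominated_graph_extension_value G v : dominated_graph G -> G !=set0 ->
  exists c : R, forall x r t, G (x, r) -> r + t * c <= `|x + t *: v|.
Proof.
move=> [Glin Gdom] [[x0 r0] G0].
pose S := [set p.2 - `|p.1 - v| | p in G].
have G00 : G (0, 0).
  have := Glin (-1) _ _ _ _ G0 G0.
  by rewrite scaleN1r mulN1r !addNr.
have Gscale a x r : G (x, r) -> G (a *: x, a * r).
  by move=> /(Glin a _ _ _ _)/(_ G00); rewrite !addr0.
have key y s x r : G (y, s) -> G (x, r) -> r - `|x - v| <= `|y + v| - s.
  move=> Gy Gx; have := Glin 1 _ _ _ _ Gx Gy; rewrite scale1r mul1r => /Gdom.
  have : `|x + y| <= `|x - v| + `|y + v|.
    by rewrite (le_trans _ (ler_normD _ _))// addrACA addNr addr0.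
  by lra.
have hS : has_sup S.
  split; first by exists (r0 - `|x0 - v|), (x0, r0).
  by exists (`|x0 + v| - r0) => _ [[x r] Gx <-] /=; exact: key.
exists (sup S) => x r t Gx.
have lb y s : G (y, s) -> s - `|y - v| <= sup S.
  by move=> Gy; apply: ub_le_sup; [exact: hS.2|exists (y, s)].
have ub y s : G (y, s) -> sup S <= `|y + v| - s.
  by move=> Gy; apply: ge_sup; [exact: hS.1|move=> _ [[y' s'] Gy' <-] /=; exact: key].
have [t0|t0|->] := ltrgtP t 0.
- have := lb _ _ (Gscale (- t)^-1 _ _ Gx).
  have tN0 : 0 < - t by rewrite oppr_gt0.
  have -> : (- t)^-1 *: x - v = (- t)^-1 *: (x + t *: v).
    rewrite scalerDr scalerA invrN mulNr mulVf ?lt_eqF// scaleN1r.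
    by rewrite -invrN.
  rewrite normrZ ger0_norm; last by rewrite invr_ge0 ltW.
  rewrite -mulrBr ler_pdivrMl//.
  by lra.
- have := ub _ _ (Gscale t^-1 _ _ Gx).
  have -> : t^-1 *: x + v = t^-1 *: (x + t *: v).
    by rewrite scalerDr scalerA mulVf ?gt_eqF// scale1r.
  rewrite normrZ ger0_norm; last by rewrite invr_ge0 ltW.
  rewrite -mulrBr ler_pdivlMl//.
  by lra.
- by rewrite mul0r scale0r !addr0; exact: Gdom.
Qed.

(** Zorn's lemma is applied to sets [A] such that [A] together with the line
    through [(v, |v|)] is dominated, so that the empty chain is bounded too.
    *)
Lemma norming_functional (v : V) : exists f : V -> R,
  [/\ scalar f, forall x, `|f x| <= `|x| & f v = `|v|].
Proof.
pose G0 : set (V * R) := [set (a *: v, a * `|v|) | a in [set: R]].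
have G0v : G0 (v, `|v|) by exists 1 => //; rewrite scale1r mul1r.
pose P A := dominated_graph (A `|` G0).
have dG0 : dominated_graph G0.
  split=> [a x r y s [b _ [<- <-]] [c _ [<- <-]]|x r [a _ [<- <-]]].
    by exists (a * b + c) => //; rewrite scalerDl scalerA mulrDl mulrA.
  by rewrite normrZ ler_wpM2r// ler_norm.
have [A [PA Amax]] : exists A, P A /\ forall B, A `<` B -> ~ P B.
  apply: Zorn_bigcup => F FP Ftot; split.
    move=> a x r y s.
    have one X : F X -> (X `|` G0) (x, r) -> (X `|` G0) (y, s) ->
        ((\bigcup_(X in F) X) `|` G0) (a *: x + y, a * r + s).
      move=> FX Xx Xy; have [+ _] := FP _ FX.
      by move=> /(_ a _ _ _ _ Xx Xy) [?|?]; [left; exists X|right].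
    move=> [[X FX Xx]|Gx] [[Y FY Yy]|Gy].
    - have [XY|YX] := Ftot _ _ FX FY.
        by apply: (one Y) => //; left; [exact: XY|].
      by apply: (one X) => //; left; [|exact: YX].
    - by apply: (one X) => //; [left|right].
    - by apply: (one Y) => //; [right|left].
    - by right; exact: dG0.1.
  move=> x r [[X FX Xx]|Gx]; last exact: dG0.2.
  by have [_] := FP _ FX; apply; left.
set G := A `|` G0 in PA.
have Gv : G (v, `|v|) by right.
have Gtot x : exists r, G (x, r).
  apply: contrapT => xG.
  have [c cG] := dominated_graph_extension_value x PA (ex_intro _ _ Gv).
  pose B := [set (p.1 + t *: x, p.2 + t * c) | p in G & t in [set: R]].
  have GB p : G p -> B p.
    move=> Gp; exists p => //; exists 0 => //.
    by rewrite scale0r mul0r !addr0 -surjective_pairing.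
  have BG0 : B `|` G0 = B.
    by apply/seteqP; split=> p; [move=> [//|Gp]; apply: GB; right|left].
  apply: (Amax B).
    split; first by move=> p Ap; apply: GB; left.
    move=> BA; apply: xG; exists c; left; apply: BA.
    have G00 : G (0, 0).
      have := PA.1 (-1) _ _ _ _ Gv Gv.
      by rewrite scaleN1r mulN1r !addNr.
    by exists (0, 0) => //; exists 1 => //=; rewrite scale1r mul1r !add0r.
  rewrite /P BG0; split.
    move=> a _ _ _ _ [[y s] Gy [t _ [<- <-]]] [[z u] Gz [t' _ [<- <-]]] /=.
    exists (a *: y + z, a * s + u); first exact: PA.1.
    exists (a * t + t') => //=; congr pair; last by ring.
    by rewrite scalerDr scalerDl scalerA addrACA.
  by move=> _ _ [[y s] Gy [t _ [<- <-]]] /=; exact: cG.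
have [f Gf] := choice Gtot.
have Guniq x r s : G (x, r) -> G (x, s) -> r = s.
  have le r' s' : G (x, r') -> G (x, s') -> r' <= s'.
    move=> Gr Gs; have /PA.2 := PA.1 (-1) _ _ _ _ Gs Gr.
    by rewrite scaleN1r addNr mulN1r normr0 addrC subr_le0.
  by move=> Gr Gs; apply/le_anti; rewrite !le.
exists f; split.
- move=> a x y; apply: Guniq (Gf _) _. apply: PA.1; exact: Gf.
- move=> x; rewrite ler_norml (PA.2 _ _ (Gf x)) andbT lerNl.
  have G00 : G (0, 0).
    have := PA.1 (-1) _ _ _ _ Gv Gv.
    by rewrite scaleN1r mulN1r !addNr.
  have /PA.2 := PA.1 (-1) _ _ _ _ (Gf x) G00.
  by rewrite !addr0 scaleN1r normrN mulN1r.
- exact: Guniq (Gf _) _.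
Qed.

End norming_functional.

(** * Integration of bounded functions against elements of L1 *)

Section pairing.
Context d (T : measurableType d) (R : realType).
Variable mu : {finite_measure set T -> \bar R}.
Implicit Types (F G : L1 mu) (h k : T -> R) (A : set T) (M : R).

Lemma L1_measurable F : measurable_fun setT (F : T -> R).
Proof. exact: (@measurable_funPT _ _ _ _ (Lrepr F)). Qed.

Lemma L1_integrable F : mu.-integrable setT (EFin \o (F : T -> R)).
Proof. by apply/Lfun1_integrable; exact: (@LfunP _ _ _ _ _ _ (Lrepr F)). Qed.

Lemma L1_normE F : (`|F|%:E = \int[mu]_x `|(F : T -> R) x|%:E)%E.
Proof.
rewrite (_ : `|F| = Lspace_norm F)//.
by rewrite (finite_norm_fine (Lrepr F)) Lnorm1.
Qed.

(** Choosing the class by [xget] makes it a function of the plain function [f]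
    alone, without an integrability proof. *)
Definition toL1 (f : T -> R) : L1 mu :=
  xget 0 [set F : L1 mu | {ae mu, forall x, (F : T -> R) x = f x}].

Lemma toL1E (f : T -> R) : mu.-integrable setT (EFin \o f) ->
  {ae mu, forall x, (toL1 f : T -> R) x = f x}.
Proof.
move=> /Lfun1_integrable fL; rewrite /toL1; case: xgetP => [F _ //|].
move=> /(_ (Lclass (Lfun_Sub (lexx 1%E) fL))) []/=.
by apply: filterS (LclassK (Lfun_Sub (lexx 1%E) fL)) => x /= ->.
Qed.

(** Covers both everywhere bounded functions and representatives of classes in
    [Linfty]. *)
Definition ess_bounded h M :=
  measurable_fun setT h /\ {ae mu, forall x, `|h x| <= M}.

Lemma ess_bounded_everywhere h M :
  measurable_fun setT h -> (forall x, `|h x| <= M) -> ess_bounded h M.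
Proof. by move=> mh hM; split => //; apply: aeW. Qed.

Lemma ess_bounded_integrableM h M F : ess_bounded h M ->
  mu.-integrable setT (fun x => (h x * (F : T -> R) x)%:E).
Proof.
move=> [mh hM]; have mF := L1_measurable F.
apply/integrableP; split.
  by apply/measurable_EFinP; exact: measurable_funM.
apply: (@le_lt_trans _ _ (\int[mu]_x (`|M|%:E * `|(F x)%:E|))%E).
  apply: ae_ge0_le_integral => //.
  - by apply/measurableT_comp => //; apply/measurable_EFinP; exact: measurable_funM.
  - apply: emeasurable_funM => //; apply/measurableT_comp => //.
    exact/measurable_EFinP.
  - apply: filterS hM => x hx _; rewrite /= lee_fin normrM ler_wpM2r//.
    by rewrite (le_trans hx)// ler_norm.
rewrite ge0_integralZl//; last first.
  by apply/measurableT_comp => //; exact/measurable_EFinP.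
rewrite lte_mul_pinfty//.
by have /integrableP[] := L1_integrable F.
Qed.

Definition pairing h F : R := \int[mu]_x (h x * (F : T -> R) x).

Lemma pairing_ae h k F : measurable_fun setT h -> measurable_fun setT k ->
  {ae mu, forall x, h x = k x} -> pairing h F = pairing k F.
Proof.
move=> mh mk hk; have mF := L1_measurable F; congr fine.
apply: ae_eq_integral => //.
- by apply/measurable_EFinP; exact: measurable_funM.
- by apply/measurable_EFinP; exact: measurable_funM.
- by apply: filterS hk => x hkx _; rewrite hkx.
Qed.

Lemma pairing_toL1 h f : measurable_fun setT h ->
  mu.-integrable setT (EFin \o f) ->
  pairing h (toL1 f) = \int[mu]_x (h x * f x).
Proof.
move=> mh intf; have mF := L1_measurable (toL1 f); congr fine.
have /integrableP[/measurable_EFinP mf _] := intf.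
apply: ae_eq_integral => //.
- by apply/measurable_EFinP; exact: measurable_funM.
- by apply/measurable_EFinP; exact: measurable_funM.
- by apply: filterS (toL1E intf) => x fx _; rewrite fx.
Qed.

Lemma pairing_linear h M (a : R) F G : ess_bounded h M ->
  pairing h (a *: F + G) = a * pairing h F + pairing h G.
Proof.
move=> hM; have iF := ess_bounded_integrableM F hM.
have iG := ess_bounded_integrableM G hM; have [mh _] := hM.
have iaF := integrableZl measurableT a iF.
rewrite /pairing -RintegralZl// -RintegralD//.
congr fine; apply: ae_eq_integral => //.
- by apply/measurable_EFinP/measurable_funM => //; exact: L1_measurable.
- apply/measurable_EFinP/measurable_funD; apply: measurable_funM => //.
    by apply: measurable_funM => //; exact: L1_measurable.
  exact: L1_measurable.
- near=> x => _.
  rewrite (near (LaddE (a *: F) G) x)// (near (LscaleE a F) x)//.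
  by congr EFin; ring.
Unshelve. all: by end_near. Qed.

Lemma pairing0r h M : ess_bounded h M -> pairing h 0 = 0.
Proof.
move=> /(pairing_linear 1 0 0); rewrite scaler0 addr0 mul1r.
by move=> /(congr1 (fun x => x - pairing h 0)); rewrite addrK subrr.
Qed.

Lemma pairingD h M F G : ess_bounded h M ->
  pairing h (F + G) = pairing h F + pairing h G.
Proof. by move=> /(pairing_linear 1 F G); rewrite scale1r mul1r. Qed.

Lemma pairingZ h M a F : ess_bounded h M ->
  pairing h (a *: F) = a * pairing h F.
Proof.
move=> hM; rewrite -[a *: F]addr0 (pairing_linear _ _ _ hM).
by rewrite (pairing0r hM) addr0.
Qed.

Lemma pairingB h M F G : ess_bounded h M ->
  pairing h (F - G) = pairing h F - pairing h G.
Proof.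
by move=> hM; rewrite (pairingD _ _ hM) -scaleN1r (pairingZ _ _ hM) mulN1r.
Qed.

Lemma pairing_linearl h M k M' (a : R) F : ess_bounded h M -> ess_bounded k M' ->
  pairing (fun x => a * h x + k x) F = a * pairing h F + pairing k F.
Proof.
move=> /(ess_bounded_integrableM F) iF /(ess_bounded_integrableM F) iG.
have iaF := integrableZl measurableT a iF.
rewrite /pairing -RintegralZl// -RintegralD//.
by apply: eq_Rintegral => x _; ring.
Qed.

Lemma pairingZl h M (a : R) F : ess_bounded h M ->
  pairing (fun x => a * h x) F = a * pairing h F.
Proof.
move=> /(ess_bounded_integrableM F) iF; rewrite /pairing -RintegralZl//.
by apply: eq_Rintegral => x _; rewrite mulrA.
Qed.

(** The elementary case of Hoelder's inequality; it also shows that [h] cannot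
    be essentially smaller than the functional it induces. *)
Lemma pairing_le h M F : 0 <= M -> ess_bounded h M -> `|pairing h F| <= M * `|F|.
Proof.
move=> M0 hM; have iF := ess_bounded_integrableM F hM; have [mh hM'] := hM.
have mF := L1_measurable F.
rewrite (le_trans (le_normr_Rintegral _ _))//.
rewrite -lee_fin fineK; last first.
  by apply: integrable_fin_num => //; exact: integrable_norm.
rewrite EFinM L1_normE -ge0_integralZl//=; last first.
  by apply/measurable_EFinP; exact: measurableT_comp.
apply: ae_ge0_le_integral => //=.
- by apply/measurable_EFinP/measurableT_comp => //; exact: measurable_funM.
- by move=> x _; rewrite mule_ge0.
- by apply/measurable_EFinP/measurable_funM => //; exact: measurableT_comp.
- by apply: filterS hM' => x hx _; rewrite lee_fin normrM ler_wpM2r.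
Qed.

End pairing.

(** * The dual of L1 *)

Section toL1_theory.
Context d (T : measurableType d) (R : realType).
Variable mu : {finite_measure set T -> \bar R}.
Implicit Types (F G : L1 mu) (f g : T -> R) (A B : set T).

Lemma toL1_linear (a : R) f g :
  mu.-integrable setT (EFin \o f) -> mu.-integrable setT (EFin \o g) ->
  toL1 mu (fun x => a * f x + g x) = a *: toL1 mu f + toL1 mu g.
Proof.
move=> intf intg; apply: Lspace_eq.
have iaf := integrableZl measurableT a intf.
have int : mu.-integrable setT (EFin \o (fun x => a * f x + g x)).
  exact: (integrableD measurableT iaf intg).
near=> x.
rewrite (near (toL1E int) x)// (near (LaddE (a *: toL1 mu f) (toL1 mu g)) x)//.
rewrite (near (LscaleE a (toL1 mu f)) x)// (near (toL1E intf) x)//.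
by rewrite (near (toL1E intg) x).
Unshelve. all: by end_near. Qed.

Lemma toL1_id F : toL1 mu (F : T -> R) = F.
Proof. exact/Lspace_eq/toL1E/L1_integrable. Qed.

Lemma toL1_norm f : mu.-integrable setT (EFin \o f) ->
  (`|toL1 mu f|%:E = \int[mu]_x `|f x|%:E)%E.
Proof.
move=> intf; rewrite L1_normE.
have /integrableP[/measurable_EFinP mf _] := intf.
apply: ae_eq_integral => //.
- by apply/measurable_EFinP/measurableT_comp => //; exact: L1_measurable.
- by apply/measurable_EFinP/measurableT_comp.
- by apply: filterS (toL1E intf) => x fx _; rewrite fx.
Qed.

Definition indL1 A : L1 mu := toL1 mu \1_A.

Lemma indL1_norm A : measurable A -> (`|indL1 A|%:E = mu A)%E.
Proof.
move=> mA; rewrite toL1_norm; last exact: integrable_indic.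
under eq_integral do rewrite ger0_norm//.
by rewrite integral_indic// setIT.
Qed.

Lemma indL1U A B : measurable A -> measurable B -> A `&` B = set0 ->
  indL1 (A `|` B) = indL1 A + indL1 B.
Proof.
move=> mA mB AB; rewrite -[X in _ = X + _]scale1r -toL1_linear;
  [|exact: integrable_indic..].
congr toL1; apply/funext => x; rewrite mul1r !indicE in_setU.
have [xA|xA] := boolP (x \in A); have [xB|xB] := boolP (x \in B) => /=;
  rewrite ?addr0 ?add0r//.
by have : set0 x by rewrite -AB; split; exact: set_mem.
Qed.

Lemma pairing_indL1 h M A : measurable A -> ess_bounded mu h M ->
  pairing h (indL1 A) = \int[mu]_(x in A) h x.
Proof.
move=> mA [mh hM]; rewrite pairing_toL1//; last exact: integrable_indic.
rewrite [RHS]Rintegral_mkcond; apply: eq_Rintegral => x _.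
by rewrite patchE indicE; case: ifP => _; rewrite ?mulr1 ?mulr0.
Qed.

(** The unit vectors on which integration against [h] evaluates to averages of
    [h]. *)
Definition avgL1 A : L1 mu := (fine (mu A))^-1 *: indL1 A.

Lemma avgL1_norm A : measurable A -> (0 < mu A)%E -> `|avgL1 A| = 1.
Proof.
move=> mA A0; have m0 : 0 < fine (mu A).
  by rewrite fine_gt0// A0/= ltey_eq fin_num_measure.
rewrite normrZ gtr0_norm ?invr_gt0//.
have -> : `|indL1 A| = fine (mu A).
  by apply: EFin_inj; rewrite indL1_norm// fineK// fin_num_measure.
by rewrite mulVf// gt_eqF.
Qed.

Lemma pairing_avgL1_ge (h : T -> R) (M c : R) A : measurable A -> (0 < mu A)%E ->
  measurable_fun setT h -> (forall x, `|h x| <= M) ->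
  (forall x, A x -> c <= h x) -> c <= pairing h (avgL1 A).
Proof.
move=> mA A0 mh hM ch; have m0 : 0 < fine (mu A).
  by rewrite fine_gt0// A0/= ltey_eq fin_num_measure.
have hb := ess_bounded_everywhere mu mh hM.
rewrite (pairingZ _ _ hb) (pairing_indL1 mA hb) ler_pdivlMl// mulrC.
rewrite -Rintegral_cst//; apply: le_Rintegral => //.
  exact: finite_measure_integrable_cst.
apply: (@le_integrable _ _ _ _ _ _ _ (EFin \o cst M)) => //.
- by apply/measurable_EFinP; exact: measurable_funTS.
- by move=> x _; rewrite /= lee_fin (le_trans (hM x))// ler_norm.
- exact: finite_measure_integrable_cst.
Qed.

End toL1_theory.

Section ae_bounds.
Context d (T : measurableType d) (R : realType).
Variable mu : {finite_measure set T -> \bar R}.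

(** The set where [f > M] carries no mass of [f - M], which is positive there.
    *)
Lemma ae_le_of_Rintegral (f : T -> R) (M : R) :
  mu.-integrable setT (EFin \o f) ->
  (forall A, measurable A -> \int[mu]_(x in A) f x <= M * fine (mu A)) ->
  {ae mu, forall x, f x <= M}.
Proof.
move=> intf fM; have /integrableP[/measurable_EFinP mf _] := intf.
pose A := [set x | M < f x].
have mA : measurable A.
  rewrite (_ : A = f @^-1` `]M, +oo[).
    by rewrite -[X in measurable X]setTI; exact: mf.
  by apply/seteqP; split=> x; rewrite /A/= in_itv/= andbT.
have intfA : mu.-integrable A (EFin \o f) by exact: integrableS intf.
have intMA : mu.-integrable A (EFin \o cst M).
  exact: finite_measure_integrable_cst.
have intA : mu.-integrable A (EFin \o (fun x => f x - M)).
  by have := integrableB mA intfA intMA.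
have mfA : measurable_fun A (EFin \o (fun x => f x - M)).
  by have /integrableP[] := intA.
have : (\int[mu]_(x in A) `|(EFin \o (fun x => f x - M)%R) x| = 0)%E.
  rewrite -[LHS]fineK; last first.
    by apply: integrable_fin_num => //; exact: integrable_abse.
  congr EFin; apply/eqP; rewrite eq_le; apply/andP; split; last first.
    by rewrite fine_ge0// integral_ge0.
  rewrite (_ : fine _ = \int[mu]_(x in A) (f x - M)).
    by rewrite RintegralB// Rintegral_cst// subr_le0 fM.
  congr fine; apply: eq_integral => x; rewrite inE /A/= => Mf.
  by rewrite ger0_norm// subr_ge0 ltW.
move=> /(ae_eq_integral_abs mu mA mfA).
apply: filterS => x /= fx; rewrite leNgt; apply/negP => Mf.
have [/eqP] := fx Mf.
by rewrite subr_eq0 gt_eqF.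
Qed.

End ae_bounds.

Section duality.
Context d (T : measurableType d) (R : realType).
Variable mu : {finite_measure set T -> \bar R}.
Variables (phi : L1 mu -> R) (M : R).
Hypotheses (phi_lin : scalar phi) (phi_le : forall F, `|phi F| <= M * `|F|).

(** The charge whose density with respect to [mu] represents [phi]. *)
Definition functional_charge (A : set T) : \bar R := (phi (indL1 mu A))%:E.

Lemma functional_charge0 : functional_charge set0 = 0%E.
Proof.
rewrite /functional_charge (_ : indL1 mu set0 = 0) ?functional0//.
apply/eqP; rewrite -normr_eq0 -eqe.
by rewrite indL1_norm// measure0.
Qed.

Lemma functional_charge_finite A : measurable A ->
  functional_charge A \is a fin_num.
Proof. by []. Qed.

Lemma functional_charge_sum (F : nat -> set T) n :
  (forall i, measurable (F i)) -> trivIset setT F ->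
  phi (indL1 mu (\big[setU/set0]_(i < n) F i)) =
  \sum_(0 <= i < n) phi (indL1 mu (F i)).
Proof.
move=> mF tF; elim: n => [|n ih].
  by rewrite big_ord0 big_nil; have [] := functional_charge0.
rewrite big_ord_recr big_nat_recr//= indL1U ?(functionalD _ _ phi_lin) ?ih//.
  exact: bigsetU_measurable.
rewrite (@trivIset_bigsetUI _ xpredT)//.
by rewrite [X in trivIset X F](_ : _ = setT)//; exact/seteqP.

Qed.

(** The tail of a disjoint union has small measure, hence its indicator has
    small norm in [L1]. *)
Lemma functional_charge_sigma_additive :
  semi_sigma_additive functional_charge.
Proof.
move=> F mF tF mUF; rewrite /functional_charge.
rewrite (_ : (fun n => _) =
    EFin \o (fun n => \sum_(0 <= i < n) phi (indL1 mu (F i)))); last first.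
  by apply/funext => n; rewrite /= sumEFin.
apply/fine_cvgP; split; first exact: nearW.
rewrite (_ : fine \o _ = fun n => \sum_(0 <= i < n) phi (indL1 mu (F i)))//.
set U := \bigcup_n F n.
pose B n := \big[setU/set0]_(i < n) F i.
have mB n : measurable (B n) by exact: bigsetU_measurable.
have BU n : B n `<=` U by exact: bigsetU_bigcup.
have muB : fine \o (mu \o B) @ \oo --> fine (mu U).
  apply: fine_cvg; rewrite fineK ?fin_num_measure//.
  rewrite (_ : mu \o B = fun n => \sum_(0 <= i < n) mu (F i))%E.
    exact: measure_semi_sigma_additive.
  apply/funext => n /=; rewrite big_mkord measure_semi_additive//.
  exact: mB.
apply/cvgrPdist_le => e e0.
have M1 : 0 < `|M| + 1 by rewrite ltr_wpDl.
move/cvgrPdist_le/(_ (e / (`|M| + 1))): muB => /(_ (divr_gt0 e0 M1)).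
apply: filterS => n /=; rewrite ler_pdivlMr// => muBn.
rewrite -functional_charge_sum// -/(B n).
have -> : indL1 mu U = indL1 mu (B n) + indL1 mu (U `\` B n).
  by rewrite -indL1U ?setDUK ?setDIK//; exact: measurableD.
rewrite (functionalD _ _ phi_lin) addrAC subrr add0r (le_trans (phi_le _))//.
have muUB : `|indL1 mu (U `\` B n)| = fine (mu U) - fine (mu (B n)).
  apply: EFin_inj; rewrite indL1_norm; last exact: measurableD.
  rewrite measureD//; last by rewrite ltey_eq fin_num_measure.
  by rewrite (setIidr (BU n)) EFinB !fineK ?fin_num_measure.
rewrite (le_trans _ muBn)// -muUB normr_id mulrC ler_wpM2l//.
by rewrite (le_trans (ler_norm _))// lerDl.
Qed.

HB.instance Definition _ := isCharge.Build _ _ _ functional_charge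
  functional_charge0 functional_charge_finite functional_charge_sigma_additive.

Lemma functional_charge_dominated : functional_charge `<< mu.
Proof.
apply/null_content_dominatesP => A mA muA0; rewrite /functional_charge.
rewrite (_ : indL1 mu A = 0) ?functional0//.
by apply/eqP; rewrite -normr_eq0 -eqe indL1_norm// muA0.
Qed.



(** The Radon-Nikodym density is bounded by [|M|] only almost everywhere,
    hence the truncation. *)
Lemma functional_density : exists h : T -> R,
  [/\ measurable_fun setT h, (forall x, `|h x| <= `|M|)
    & forall A, measurable A -> phi (indL1 mu A) = pairing h (indL1 mu A)].
Proof.
pose f := Radon_Nikodym functional_charge mu.
have intf : mu.-integrable setT f.
  exact/Radon_Nikodym_integrable/functional_charge_dominated.
have ffin x : f x \is a fin_num.
  exact/Radon_Nikodym_fin_num/functional_charge_dominated.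
have fE : f = EFin \o (fine \o f) by apply/funext => x; rewrite /= fineK.
have mf : measurable_fun setT (fine \o f).
  by apply/measurable_EFinP; rewrite -fE; have /integrableP[] := intf.
have phif A : measurable A -> phi (indL1 mu A) = \int[mu]_(x in A) fine (f x).
  move=> mA; apply: EFin_inj; rewrite -[LHS]/(functional_charge A).
  rewrite (Radon_Nikodym_integral functional_charge_dominated mA) -/f.
  rewrite fineK; last first.
    apply: integrable_fin_num => //.
    by apply: (integrableS measurableT) => //; rewrite fE in intf.
  by apply: eq_integral => x _; rewrite fineK.
have f_le : {ae mu, forall x, fine (f x) <= `|M|}.
  apply: ae_le_of_Rintegral; first by rewrite fE in intf.
  move=> A mA; rewrite -phif// (le_trans (ler_norm _))// (le_trans (phi_le _))//.
  rewrite -indL1_norm//= ler_wpM2r// ler_norm//.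
have f_ge : {ae mu, forall x, - fine (f x) <= `|M|}.
  apply: ae_le_of_Rintegral.
    by have := integrableN intf; rewrite fE.
  move=> A mA; under eq_Rintegral do rewrite -mulN1r.
  rewrite RintegralZl//; last first.
    by apply: (integrableS measurableT) => //; rewrite fE in intf.
  rewrite -phif// mulN1r (le_trans (ler_norm _))// normrN.
  by rewrite (le_trans (phi_le _))// -indL1_norm//= ler_wpM2r// ler_norm.
pose h x := Num.max (- `|M|) (Num.min `|M| (fine (f x))).
have mh : measurable_fun setT h.
  by apply: measurable_maxr => //; exact: measurable_minr.
have hM x : `|h x| <= `|M|.
  rewrite ler_norml /h le_max lexx/= ge_max ge_min lexx/= andbT.
  by rewrite (le_trans _ (normr_ge0 M))// oppr_le0.
have hf : {ae mu, forall x, h x = fine (f x)}.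
  apply: filterS2 f_le f_ge => x fle fge; rewrite /h (min_idPr fle).
  by apply/max_idPr; rewrite lerNl.
exists h; split => // A mA.
rewrite phif// (pairing_indL1 mA (ess_bounded_everywhere _ mh hM)).
congr fine; apply: ae_eq_integral => //.
- by apply/measurable_EFinP; exact: measurable_funTS.
- by apply/measurable_EFinP; exact: measurable_funTS.
- by apply: filterS hf => x hfx _; rewrite hfx.
Qed.

Import HBSimple.

Lemma functional_eq_on_sfun (h : T -> R) (M' : R) (g : {sfun T >-> R}) :
  ess_bounded mu h M' ->
  (forall A, measurable A -> phi (indL1 mu A) = pairing h (indL1 mu A)) ->
  phi (toL1 mu g) = pairing h (toL1 mu g).
Proof.
move=> hb hA.
have sumE (s : seq R) :
    mu.-integrable setT
      (EFin \o (fun x => \sum_(y <- s) (y * \1_(g @^-1` [set y]) x))) /\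
    phi (toL1 mu (fun x => \sum_(y <- s) (y * \1_(g @^-1` [set y]) x))) =
    pairing h (toL1 mu (fun x => \sum_(y <- s) (y * \1_(g @^-1` [set y]) x))).
  elim: s => [|y s [ints ih]].
    under eq_fun do rewrite big_nil.
    rewrite (_ : (fun=> 0) = \1_(@set0 T)) ?indic0//; split.
      exact: integrable0.
    by have := hA _ (@measurable0 _ T); rewrite /indL1 indic0.
  have mgy : measurable (g @^-1` [set y]) by exact: measurable_sfunP.
  have inty := integrable_indic mu mgy.
  under eq_fun do rewrite big_cons.
  split.
    exact: (integrableD measurableT (integrableZl measurableT y inty) ints).
  rewrite toL1_linear// (functionalD _ _ phi_lin) (functionalZ _ _ phi_lin).
  rewrite (pairing_linear _ _ _ hb).
  by rewrite ih -/(indL1 mu _) hA.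
have -> : (g : T -> R) = fun x =>
    \sum_(y <- finmap.enum_fset (fset_set (range g))) (y * \1_(g @^-1` [set y]) x).
  by apply/funext => x; rewrite fimfunE fsbig_finite.
exact: (sumE _).2.
Qed.

(** Both sides agree on indicators and are continuous, and simple functions
    are dense. *)
Lemma L1_dual_representation : exists h : T -> R,
  [/\ measurable_fun setT h, (forall x, `|h x| <= `|M|)
    & forall F, phi F = pairing h F].
Proof.
have [h [mh hM hA]] := functional_density.
have hb : ess_bounded mu h `|M| by exact: ess_bounded_everywhere.
exists h; split => // F.
have [g [intg _ gF]] := approximation_sfun_integrable measurableT (L1_integrable F).
have phig n := functional_eq_on_sfun (g n) hb hA.
have dist n : (`|F - toL1 mu (g n)|%:E =
    \int[mu]_z `|((F : T -> R) z)%:E - (g n z)%:E|)%E.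
  have intgF := integrableD measurableT
    (integrableZl measurableT (- 1) (intg n)) (L1_integrable F).
  rewrite -[X in X - _]toL1_id addrC -scaleN1r -toL1_linear ?toL1_norm//.
    by apply: eq_integral => x _; rewrite -EFinB mulN1r addrC.
  exact: L1_integrable.
have bound n : `|phi F - pairing h F| <= 2 * `|M| * `|F - toL1 mu (g n)|.
  have -> : phi F - pairing h F =
      phi (F - toL1 mu (g n)) - pairing h (F - toL1 mu (g n)).
    by rewrite (functionalB _ _ phi_lin) (pairingB _ _ hb) phig; ring.
  rewrite (le_trans (ler_normB _ _))// -mulrA mulr_natl mulr2n lerD//.
    by rewrite (le_trans (phi_le _))// ler_wpM2r// ler_norm.
  exact: pairing_le.
apply/eqP; rewrite -subr_eq0 -normr_le0; apply/ler_addgt0Pr => e e0.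
rewrite add0r.
have M1 : 0 < 2 * `|M| + 1 by rewrite ltr_wpDl// mulr_ge0.
move/fine_cvgP : gF => [_ /cvgrPdist_le/(_ (e / (2 * `|M| + 1)))].
move=> /(_ (divr_gt0 e0 M1)) [n _ /(_ n (leqnn n))] /=.
rewrite -dist/= sub0r normrN normr_id ler_pdivlMr// => gn.
rewrite (le_trans (bound n))// (le_trans _ gn)// mulrC ler_wpM2l//.
by rewrite lerDl.
Qed.

End duality.

(** * The Daugavet property tested on functionals *)

Section daugavet_criterion.
Context (R : realType) (V : normedModType R).

Lemma scalar_is_linear (f : V -> R) (v : V) : scalar f ->
  linear (fun x => f x *: v).
Proof. by move=> flin a x y; rewrite flin scalerDl scalerA. Qed.

Lemma operator_norm_has_sup (f : V -> V) (C : R) :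
  (forall x, `|f x| <= C * `|x|) -> 0 <= C ->
  has_sup [set `|f x| | x in [set x : V | `|x| <= 1]].
Proof.
move=> fC C0; split; first by exists `|f 0|, 0 => //=; rewrite normr0.
exists C => _ [x /= x1 <-]; rewrite (le_trans (fC _))//.
by rewrite ler_piMr.
Qed.

(** The Daugavet equation for the operator [x |-> f x *: v], whose norm is 1,
    unfolded as an almost attained supremum. *)
Lemma Daugavet_rank_one (f : V -> R) (v : V) (delta : R) :
  Daugavet_property V -> scalar f -> (forall x, `|f x| <= `|x|) ->
  (exists2 x, `|x| <= 1 & f x = 1) -> `|v| = 1 -> 0 < delta ->
  exists2 x, `|x| <= 1 & 2 - delta < `|x + f x *: v|.
Proof.
move=> DV flin fle [u u1 fu] v1 delta0.
pose T := fun x => f x *: v.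
pose LT : {linear V -> V} :=
  HB.pack T (GRing.isLinear.Build R V V _ T (scalar_is_linear v flin)).
have Tle x : `|T x| <= 1 * `|x| by rewrite normrZ v1 mulr1 mul1r.
have ITle x : `|x + T x| <= 2 * `|x|.
  by rewrite mulr_natl mulr2n (le_trans (ler_normD _ _))// lerD2l -[leRHS]mul1r.
have cT : continuous LT.
  apply/bounded_linear_continuous/linear_boundedP; exists 1; split => // r r1 x.
  by rewrite (le_trans (Tle x))// ler_wpM2r// ltW.
have r1 : rank_one LT.
  exists v; first by rewrite -normr_eq0 v1 oner_neq0.
  apply/seteqP; split=> [_ [x _ <-]|_ [a _ <-]]; first by exists (f x).
  by exists (a *: u) => //=; rewrite /T (functionalZ _ _ flin) fu mulr1.
have T1 : 1 <= operator_norm LT.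
  apply: ub_le_sup; first by have [] := operator_norm_has_sup Tle ler01.
  by exists u => //=; rewrite /T fu scale1r.
have := DV LT cT r1 => DT.
have hs := operator_norm_has_sup ITle (ler0n _ 2).
have [_ [x /= x1 <-] xlt] := sup_adherent delta0 hs.
exists x => //; apply: le_lt_trans xlt; rewrite lerD2r.
by rewrite -[X in _ <= X]/(operator_norm (fun x => x + LT x)) DT; lra.
Qed.

(** Every rank-one operator is [x |-> f x *: v] with [|v| = 1], and then its
    norm is that of [f]. *)
Lemma Daugavet_of_almost_norming :
  (forall (f : V -> R) (N : R) (v : V) (delta : R),
    scalar f -> 0 < N -> (forall x, `|f x| <= N * `|x|) ->
    (forall e, 0 < e -> exists2 x, `|x| <= 1 & N - e < f x) ->
    `|v| = 1 -> 0 < delta ->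
    exists2 x, `|x| <= 1 & 1 + N - delta <= `|x + f x *: v|) ->
  Daugavet_property V.
Proof.
move=> H T cT [y y0 rT].
have yN : 0 < `|y| by rewrite normr_gt0.
have /choice[f0 f0T] : forall x, exists a, T x = a *: y.
  move=> x; have : range T (T x) by exists x.
  by rewrite rT => -[a _ <-]; exists a.
pose v := `|y|^-1 *: y; pose f x := `|y| * f0 x.
have v1 : `|v| = 1 by rewrite normrZ normfV normr_id mulVf// gt_eqF.
have v0 : v != 0 by rewrite -normr_eq0 v1 oner_neq0.
have fT x : T x = f x *: v.
  by rewrite scalerA mulrAC mulfV ?gt_eqF// mul1r.
have flin : scalar f.
  move=> a x z; apply/eqP; rewrite -subr_eq0.
  have : (f (a *: x + z) - (a * f x + f z)) *: v = 0.
    by rewrite scalerBl scalerDl -(scalerA a) -!fT linearP subrr.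
  by move=> /eqP; rewrite scaler_eq0 (negPf v0) orbF.
have Tf x : `|T x| = `|f x| by rewrite fT normrZ v1 mulr1.
have [C [Creal CT]] :=
  (linear_boundedP T).1 (continuous_linear_bounded 0 (cT 0)).
pose C' := `|C| + 1.
have C'0 : 0 <= C' by rewrite addr_ge0.
have C'T x : `|T x| <= C' * `|x|.
  by apply: CT; rewrite (le_lt_trans (ler_norm _))// ltrDl.
have hsT := operator_norm_has_sup C'T C'0.
set N := operator_norm T.
have N0 : 0 <= N.
  by rewrite (@le_trans _ _ `|T 0|)//; apply: ub_le_sup;
    [exact: hsT.2|exists 0 => //=; rewrite normr0].
have TN x : `|T x| <= N * `|x|.
  have [->|x0] := eqVneq x 0; first by rewrite linear0 !normr0 mulr0.
  have xN : 0 < `|x| by rewrite normr_gt0.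
  have -> : `|T x| = `|T (`|x|^-1 *: x)| * `|x|.
    by rewrite linearZ normrZ normfV normr_id mulrAC mulVf ?gt_eqF// mul1r.
  rewrite ler_wpM2r//; apply: ub_le_sup; first exact: hsT.2.
  exists (`|x|^-1 *: x) => //=.
  by rewrite normrZ normfV normr_id mulVf// gt_eqF.
have ITle x : `|x + T x| <= (1 + N) * `|x|.
  by rewrite mulrDl mul1r (le_trans (ler_normD _ _))// lerD2l.
have hsIT := operator_norm_has_sup ITle (addr_ge0 ler01 N0).
apply/eqP; rewrite eq_le; apply/andP; split.
  apply: ge_sup; first exact: hsIT.1.
  by move=> _ [x /= x1 <-]; rewrite (le_trans (ITle x))// ler_piMr// addr_ge0.
have Ngt0 : 0 < N.
  have : range T y by rewrite rT; exists 1 => //; rewrite scale1r.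
  move=> [x _ xy]; have := TN x; rewrite xy lt_neqAle N0 andbT.
  by apply: contraTneq => <-; rewrite mul0r -ltNge.
apply/ler_addgt0Pr => delta delta0.
have [||x x1 xN] := H f N v delta flin Ngt0 _ _ v1 delta0.
- by move=> x; rewrite -Tf.
- move=> e e0; have [_ [x /= x1 <-] xN] := sup_adherent e0 hsT.
  have [fx0|fx0] := leP 0 (f x).
    by exists x => //; move: xN; rewrite Tf ger0_norm.
  exists (- x); first by rewrite normrN.
  by rewrite (functionalN _ flin); move: xN; rewrite Tf ltr0_norm.
rewrite -lerBlDr (le_trans xN)//.
by apply: ub_le_sup; [exact: hsIT.2|exists x => //=; rewrite fT].
Qed.

End daugavet_criterion.

(** * Functionals on quotients of L1 *)

Section quotient_functionals.
Context d (T : measurableType d) (R : realType).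
Variable mu : {finite_measure set T -> \bar R}.
Variable Z : closedSubspace (L1 mu).
Local Notation Q := (quotient_space Z).
Local Notation pi := (\pi_Q)%qT.

Lemma quotient_piZ (a : R) (F : L1 mu) : pi (a *: F) = a *: (pi F : Q).
Proof. by rewrite -[RHS]/(quotient_scale _ _) quotient_scale_pi. Qed.

Lemma quotient_pi_le (F : L1 mu) : `|pi F : Q| <= `|F|.
Proof. exact: quotient_norm_le. Qed.

Lemma quotient_pi_eq0 (F : L1 mu) : F \in Z -> pi F = 0 :> Q.
Proof.
by move=> FZ; rewrite -(quotient_pi0 Z); apply/quotient_eqP; rewrite subr0.
Qed.

Lemma quotient_repr_norm (q : Q) (e : R) : 0 < e ->
  exists2 F : L1 mu, pi F = q & `|F| < `|q| + e.
Proof. exact: quotient_norm_adherent. Qed.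

Lemma quotient_functional_representation (f : Q -> R) (M : R) : 0 <= M ->
  scalar f -> (forall q, `|f q| <= M * `|q|) ->
  exists h : T -> R, [/\ measurable_fun setT h, (forall x, `|h x| <= M)
    & forall F, f (pi F) = pairing h F].
Proof.
move=> M0 flin fle.
have flin' : scalar (fun F : L1 mu => f (pi F)).
  by move=> a F G; rewrite quotient_piD quotient_piZ flin.
have fle' F : `|f (pi F)| <= M * `|F|.
  by rewrite (le_trans (fle _))// ler_wpM2l// quotient_pi_le.
have [h [mh hM fh]] := L1_dual_representation flin' fle'.
by exists h; split => // x; rewrite -[leRHS](ger0_norm M0).
Qed.

(** The quotient norm is the infimum of the norms of the representatives, so a
    bound on representatives descends. *)
Lemma quotient_functional_le (f : Q -> R) (M : R) : 0 <= M ->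
  (forall F : L1 mu, `|f (pi F)| <= M * `|F|) -> forall q, `|f q| <= M * `|q|.
Proof.
move=> M0 fle q; apply/ler_addgt0Pr => e e0.
have M1 : 0 < M + 1 by rewrite ltr_wpDl.
have [F <- Fq] := quotient_repr_norm q (divr_gt0 e0 M1).
rewrite (le_trans (fle _))//.
rewrite (@le_trans _ _ (M * (`|pi F : Q| + e / (M + 1))))//.
  by rewrite ler_wpM2l// ltW.
by rewrite mulrDr lerD2l mulrCA ger_pMr// ler_pdivrMr// mul1r lerDl.
Qed.

End quotient_functionals.

Section kernel.
Context d (T : measurableType d) (R : realType).
Variable mu : {finite_measure set T -> \bar R}.
Variables (Z : closedSubspace (L1 mu)) (y : T -> R) (M : R).
Hypothesis yM : ess_bounded mu y M.

Definition kernel_pred : {pred L1 mu} :=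
  fun F => (F \in Z) && (pairing y F == 0).

Lemma kernel_submod : submod_closed kernel_pred.
Proof.
split; first by rewrite /in_mem/= /kernel_pred rpred0 (pairing0r yM) eqxx.
move=> a F G; rewrite /in_mem/= /kernel_pred => /andP[FZ /eqP F0] /andP[GZ /eqP G0].
by rewrite rpredD ?rpredZ//= (pairing_linear _ _ _ yM) F0 G0 mulr0 addr0.
Qed.

Lemma kernel_closed : closed [set F | F \in kernel_pred].
Proof.
move=> F Fcl; rewrite /in_mem/= /kernel_pred; apply/andP; split.
  apply: (@subspace_closed _ _ Z) => B BF.
  by have [G [/andP[GZ _] BG]] := Fcl B BF; exists G.
rewrite -normr_le0; apply/ler_addgt0Pr => e e0; rewrite add0r.
pose C := `|M| + 1.
have C0 : 0 < C by rewrite ltr_wpDl.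
have [G [/andP[_ /eqP G0]]] := Fcl _ (nbhsx_ballx F (e / C) (divr_gt0 e0 C0)).
rewrite -ball_normE /= => FG.
rewrite -[pairing y F]subr0 -G0 -(pairingB _ _ yM).
have yC : ess_bounded mu y C.
  case: yM => my yle; split => //; apply: filterS yle => x /le_trans; apply.
  by rewrite (le_trans (ler_norm _))// lerDl.
rewrite (le_trans (pairing_le _ (ltW C0) yC))//.
by rewrite mulrC -ler_pdivlMr// ltW.
Qed.

Definition kernel_subspace : closedSubspace (L1 mu) :=
  ClosedSubspace kernel_submod kernel_closed.

End kernel.

Section positive_measure.
Context d (T : measurableType d) (R : realType).
Variable mu : {measure set T -> \bar R}.

Lemma measure_gt0_or_ae (A : set T) : measurable A ->
  (0 < mu A)%E \/ {ae mu, forall x, ~ A x}.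
Proof.
move=> mA; have [A0|A0] := eqVneq (mu A) 0%E.
  by right; exists A; split => // x /contrapT.
by left; rewrite lt0e A0 measure_ge0.
Qed.

Lemma ae_not_measure0 (A : set T) : measurable A ->
  {ae mu, forall x, ~ A x} -> mu A = 0%E.
Proof.
move=> mA [N [mN N0 AN]]; apply: (subset_measure0 mA mN _ N0) => x Ax.
by apply: AN => /= /(_ Ax).
Qed.

Lemma measurable_gt (f : T -> R) (c : R) : measurable_fun setT f ->
  measurable [set x | c < f x].
Proof.
move=> mf; rewrite (_ : [set _ | _] = f @^-1` `]c, +oo[).
  by rewrite -[X in measurable X]setTI; exact: mf.
by apply/seteqP; split=> x /=; rewrite in_itv/= andbT.
Qed.

End positive_measure.

(** * Flipping a sign modulo a poor subspace *)

(** With [rho] the norm of the class of [x1] and [rho * p] the value of [h] at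
    [x1], this is the error made on [x1] by the convex combination in
    [poor_flip]. *)
Lemma flip_error (R : realFieldType) (rho p delta : R) :
  1 <= rho -> p <= 1 -> 1 - delta < p ->
  `|2 * ((rho * p - rho) / (rho + 1))| <= 2 * delta.
Proof.
move=> rho1 p1 pd; rewrite normrM ger0_norm// ler_wpM2l//.
have rho0 : 0 < rho + 1 by lra.
rewrite normrM normfV (gtr0_norm rho0) ler_pdivrMr// ler0_norm; nra.
Qed.

Section poor_step.
Context d (T : measurableType d) (R : realType).
Variable mu : {finite_measure set T -> \bar R}.
Variables (Z : closedSubspace (L1 mu)).

(** A functional [psi] norming [q + f q *: v] must be almost maximal both at
    [q] and, up to the sign of [f q], at [v]. Replacing [(q, psi)] by its
    opposite makes both values positive. *)
Lemma Daugavet_quotient_functionals (Z' : closedSubspace (L1 mu))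
    (f : quotient_space Z' -> R) (v : quotient_space Z') (delta : R) :
  Daugavet_property (quotient_space Z') ->
  scalar f -> (forall q, `|f q| <= `|q|) ->
  (exists2 q, `|q| <= 1 & f q = 1) -> `|v| = 1 -> 0 < delta < 1 ->
  exists (psi : quotient_space Z' -> R) (q : quotient_space Z'),
    [/\ scalar psi, (forall q, `|psi q| <= `|q|), `|q| <= 1
      & [/\ 1 - delta < f q, 1 - delta < psi q & 1 - delta < psi v]].
Proof.
move=> DZ' flin fle fu v1 /andP[delta0 delta1].
have [q q1 qlt] := Daugavet_rank_one DZ' flin fle fu v1 delta0.
have [psi [psilin psile psiE]] := norming_functional (q + f q *: v).
move: qlt; rewrite -psiE (functionalD _ _ psilin) (functionalZ _ _ psilin) => qlt.
have /ler_normlP[fq1 fq2] : `|f q| <= 1 by rewrite (le_trans (fle _)).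
have /ler_normlP[pq1 pq2] : `|psi q| <= 1 by rewrite (le_trans (psile _)).
have /ler_normlP[pv1 pv2] : `|psi v| <= 1 by rewrite (le_trans (psile _))// v1.
have fqpv : f q * psi v <= 1 by nra.
have [fq0|fq0] := leP 0 (f q).
  exists psi, q; split => //; split; [by nra|by lra|by nra].
exists (fun x => - psi x), (- q); split.
- by move=> a x y; rewrite psilin; ring.
- by move=> x; rewrite normrN.
- by rewrite normrN.
- rewrite (functionalN _ flin) (functionalN _ psilin) opprK.
  by split; [nra|lra|nra].
Qed.

(** The Daugavet property of a quotient yields [h], close to 1 on a part of
    [D], whose action on [Z] is almost [rho] times that of [y], with [rho >=
    1]; [z] is the convex combination of [h] and [- y] that almost acts as
    [y]. *)
Lemma poor_flip (D : set T) (y : T -> R) (eta eps : R) : poor Z ->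
  measurable D -> (0 < mu D)%E -> measurable_fun setT y ->
  0 < eta <= 1 -> (forall x, ~ D x -> `|y x| <= 1 - eta) ->
  (forall x, D x -> y x = -1) -> 0 < eps ->
  exists (z : T -> R) (B : set T),
    [/\ measurable_fun setT z, (forall x, `|z x| <= 1),
      [/\ measurable B, (0 < mu B)%E, B `<=` D & forall x, B x -> 1 / 2 <= z x]
      & forall F, F \in Z -> `|pairing (z \- y) F| <= eps * `|F|].
Proof.
move=> poorZ mD D0 my /andP[eta0 eta1] yD yD1 eps0.
have y1 x : `|y x| <= 1.
  have [Dx|nDx] := pselect (D x); first by rewrite yD1// normrN normr1.
  by rewrite (le_trans (yD _ nDx))//; lra.
have yb : ess_bounded mu y 1 by exact: ess_bounded_everywhere.
have [[x1 x1P]|allZ] :=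
    pselect (exists F, [set F | F \in Z /\ pairing y F = 1] F); last first.
  (* If [y] vanishes on [Z], then so does [- y]. *)
  exists (fun x => - y x), D; split.
  - exact: measurableT_comp.
  - by move=> x; rewrite normrN.
  - by split => // x Dx; rewrite yD1//; lra.
  - move=> F FZ.
    have yF : pairing y F = 0.
      apply: contrapT => /eqP yF; apply: allZ; exists ((pairing y F)^-1 *: F).
      by rewrite /= rpredZ// (pairingZ _ _ yb) mulVf.
    rewrite (_ : _ \- _ = fun x => - 2 * y x); last first.
      by apply/funext => x /=; ring.
    by rewrite (pairingZl _ _ yb) yF mulr0 normr0 mulr_ge0// ltW.
pose Z' := kernel_subspace Z yb.
have Z'Z : {subset Z' <= Z} by move=> F /andP[].
pose f (q : quotient_space Z') := - pairing y (repr q).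
have fpi F : f (\pi_(quotient_space Z') F)%qT = - pairing y F.
  congr (- _); apply/eqP; rewrite -subr_eq0 -(pairingB _ _ yb).
  have : repr (\pi_(quotient_space Z') F)%qT - F \in Z'.
    by apply/quotient_eqP; rewrite reprK.
  by case/andP.
have flin : scalar f.
  move=> a; elim/quotW => F; elim/quotW => G.
  rewrite -quotient_piZ -quotient_piD !fpi (pairing_linear _ _ _ yb); ring.
have fle q : `|f q| <= `|q|.
  rewrite -[leRHS]mul1r; apply: quotient_functional_le => // F.
  by rewrite fpi normrN pairing_le.
have fu : exists2 q, `|q| <= 1 & f q = 1.
  have q1 : `|(\pi_(quotient_space Z') (avgL1 mu D))%qT : quotient_space Z'| <= 1.
    by rewrite (le_trans (quotient_pi_le _ _))// avgL1_norm.
  exists (\pi_(quotient_space Z') (avgL1 mu D))%qT => //.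
  apply/le_anti/andP; split.
    by rewrite (le_trans (ler_norm _))// (le_trans (fle _)).
  rewrite fpi -mulN1r -(pairingZl _ _ yb).
  apply: (pairing_avgL1_ge (M := 1)) => //; first exact: measurable_funM.
    by move=> x; rewrite mulN1r normrN.
  by move=> x Dx; rewrite mulN1r yD1// opprK.
pose p : quotient_space Z' := (\pi_(quotient_space Z') x1)%qT.
have [rho rhoE] : exists r, r = `|p| by exists `|p|.
have rho1 : 1 <= rho.
  by rewrite rhoE (le_trans _ (fle _))// fpi x1P.2 normrN normr1.
have rho0 : 0 < rho by lra.
pose v := rho^-1 *: p.
have v1 : `|v| = 1 by rewrite normrZ normfV -rhoE gtr0_norm// mulVf// gt_eqF.
(* 1/4 gives [h >= 1/2], [eta / 2] confines [B] to [D], [eps / 2] bounds the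
   error on [Z]. *)
pose delta := Num.min (1 / 4) (Num.min (eta / 2) (eps / 2)).
have delta0 : 0 < delta by rewrite !lt_min !divr_gt0.
have delta4 : delta <= 1 / 4 by rewrite ge_min lexx.
have deltaeta : delta <= eta / 2 by rewrite !ge_min lexx orbT.
have deltaeps : delta <= eps / 2 by rewrite !ge_min lexx !orbT.
have delta01 : 0 < delta < 1 by apply/andP; split => //; lra.
have [psi [q [psilin psile q1 [fq psiq psiv]]]] :=
  Daugavet_quotient_functionals (poorZ _ Z'Z) flin fle fu v1 delta01.
have psile1 x : `|psi x| <= 1 * `|x| by rewrite mul1r.
have [h [mh h1 psih]] := quotient_functional_representation ler01 psilin psile1.
have hb : ess_bounded mu h 1 by exact: ess_bounded_everywhere.
have [pv pvE] : exists r, r = psi v by exists (psi v).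
have pv1 : pv <= 1.
  by rewrite pvE -v1 (le_trans (ler_norm _))// psile.
rewrite -pvE in psiv.
have tE : pairing h x1 = rho * pv.
  by rewrite pvE (functionalZ _ _ psilin) mulrA mulfV ?gt_eqF// mul1r psih.
pose k x := -1 * y x + h x.
have mk : measurable_fun setT k.
  by apply: measurable_funD => //; exact: measurable_funM.
pose B := [set x | 2 - 2 * delta < `|k x|].
have mB : measurable B by apply: measurable_gt; exact: measurableT_comp.
have Bpos : (0 < mu B)%E.
  have [//|B0] := measure_gt0_or_ae mu mB.
  have d2 : 0 <= 2 - 2 * delta by lra.
  have kb : ess_bounded mu k (2 - 2 * delta).
    by split => //; apply: filterS B0 => x /negP; rewrite -leNgt.
  have kle F : `|psi (\pi_(quotient_space Z') F)%qT + f (\pi_(quotient_space Z') F)%qT|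
      <= (2 - 2 * delta) * `|F|.
    rewrite psih fpi addrC -mulN1r -(pairing_linearl _ _ yb hb).
    exact: pairing_le.
  have := quotient_functional_le (f := fun q => psi q + f q) d2 kle q.
  move=> /(le_trans (ler_norm _)).
  have : (2 - 2 * delta) * `|q| <= 2 - 2 * delta by rewrite ler_piMr.
  move=> q2 kq; have := lt_le_trans (ltrD psiq fq) (le_trans kq q2).
  by rewrite (_ : 1 - delta + _ = 2 - 2 * delta) ?ltxx//; ring.
clear fq psiq q1 v1 rhoE pvE.
(* Off [D], [|y| <= 1 - eta] and [|h| <= 1]. *)
have BD : B `<=` D.
  move=> x; rewrite /B/= => kx; apply: contrapT => nDx; move: kx.
  apply/negP; rewrite -leNgt /k mulN1r (le_trans (ler_normD _ _))// normrN.
  by have := yD _ nDx; have := h1 x; lra.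
have hB x : B x -> 1 / 2 <= h x.
  move=> Bx; have := Bx; rewrite /B/k/= (yD1 _ (BD _ Bx)) => {Bx}.
  have /ler_normlP[hx1 hx2] := h1 x.
  rewrite mulrNN mulr1 ger0_norm; first by lra.
  by lra.
(* The weight for which [l * rho - (1 - l) = 1]: if [h] attained the norm [rho]
   of the class of [x1], then [z] would agree with [y] on [Z]. *)
have [l lE] : exists l, l = 2 / (rho + 1) by exists (2 / (rho + 1)).
have l0 : 0 <= l by rewrite lE divr_ge0// addr_ge0// ltW.
have l1 : l <= 1 by rewrite lE ler_pdivrMr ?mul1r ?lerD2r// addr_gt0.
pose z x := (l - 1) * y x + l * h x.
exists z, B; split.
- by apply: measurable_funD; exact: measurable_funM.
- move=> x; rewrite /z (le_trans (ler_normD _ _))// !(normrM, ger0_norm l0).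
  rewrite [`|l - 1|]ler0_norm ?subr_le0// opprB.
  have l1' : 0 <= 1 - l by rewrite subr_ge0.
  rewrite (le_trans (lerD (ler_wpM2l l1' (y1 x)) (ler_wpM2l l0 (h1 x))))//.
  by rewrite !mulr1 subrK.
- split => // x Bx; rewrite /z (yD1 _ (BD _ Bx)).
  by have := hB _ Bx; nra.
- move=> F FZ.
  have hZ G : G \in Z' -> pairing h G = 0.
    by move=> GZ'; rewrite -psih quotient_pi_eq0// (functional0 psilin).
  set a := pairing y F; set t := pairing h x1.
  have hF : pairing h F = a * t.
    have := hZ (F - a *: x1); rewrite (pairingB _ _ hb) (pairingZ _ _ hb).
    move=> /(_ _)/eqP; rewrite subr_eq0 => /(_ _)/eqP; apply.
    rewrite /in_mem/= /kernel_pred rpredB ?rpredZ ?x1P.1//=.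
    by rewrite (pairingB _ _ yb) (pairingZ _ _ yb) x1P.2 mulr1 subrr.
  have aF : `|a| <= `|F| by rewrite -[leRHS]mul1r pairing_le.
  have -> : z \- y = fun x => (l - 2) * y x + (fun x => l * h x) x.
    by apply/funext => x; rewrite /z /=; ring.
  rewrite (pairing_linearl (M' := 1) _ _ yb); last first.
    split; first exact: measurable_funM.
    by apply: aeW => x; rewrite normrM (ger0_norm l0) mulr_ile1.
  rewrite (pairingZl _ _ hb) hF -/a.
  have -> : (l - 2) * a + l * (a * t) = a * (2 * ((t - rho) / (rho + 1))).
    by rewrite lE; field; rewrite gt_eqF// addr_gt0.
  rewrite normrM [leRHS]mulrC ler_pM// /t tE (le_trans (flip_error rho1 pv1 psiv))//.
  by rewrite mulrC -ler_pdivlMr.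
Qed.
End poor_step.

(** * Accumulating height on a prescribed set *)

Section staircase.
Context d (T : measurableType d) (R : realType).
Variable mu : {finite_measure set T -> \bar R}.
Variables (Z : closedSubspace (L1 mu)).

(** The induction keeps the bound 1 off [D] because there the new function is
    [z], whatever [s] was; the factor [kappa < 1] leaves the room off [D] that
    [poor_flip] demands, and costs less than the gain on [B]. *)
Lemma poor_staircase (D : set T) (n : nat) (eps : R) : poor Z ->
  measurable D -> (0 < mu D)%E -> 0 < eps ->
  exists (s : T -> R) (C : R) (B : set T),
    [/\ measurable_fun setT s, (forall x, `|s x| <= C),
      (forall x, ~ D x -> `|s x| <= 1),
      [/\ measurable B, (0 < mu B)%E, B `<=` D & forall x, B x -> n%:R <= s x]
      & forall F, F \in Z -> `|pairing s F| <= eps * `|F|].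
Proof.
move=> poorZ mD D0; elim: n eps => [|n ih] eps eps0.
  exists (cst 0), 0, D; split => //.
  - by move=> x; rewrite normr0.
  - by move=> x _; rewrite normr0.
  - by split.
  - move=> F _; rewrite (_ : pairing _ F = 0) ?normr0 ?mulr_ge0// ?ltW//.
    rewrite /pairing; under eq_Rintegral do rewrite mul0r.
    by rewrite Rintegral_cst// mul0r.
have [s [C [B [ms sC s1 [mB B0 BD sB] sZ]]]] := ih _ (divr_gt0 eps0 (ltr0n _ 2)).
(* [eta * n <= 1/2], so replacing [s] by [kappa * s] costs at most 1/2. *)
pose eta : R := (2 * n.+1%:R)^-1.
pose kappa := 1 - eta.
have eta0 : 0 < eta by rewrite invr_gt0 mulr_gt0.
have eta1 : eta <= 1.
  by rewrite invf_le1 ?mulr_gt0// -natrM ler1n.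
have kappa0 : 0 <= kappa by rewrite subr_ge0.
(* Off [D], adding [z - y] to [kappa * s] leaves [z] alone. *)
pose y x := kappa * s x * \1_(~` D) x - \1_B x.
have my : measurable_fun setT y.
  apply: measurable_funB => //; apply: measurable_funM => //.
  - exact: measurable_funM.
  - by apply: measurable_indic; exact: measurableC.
have yB x : B x -> y x = -1.
  move=> Bx; rewrite /y !indicE (mem_set Bx) memNset ?mulr0 ?sub0r//.
  by move=> /(_ (BD _ Bx)).
have yD x : ~ D x -> y x = kappa * s x.
  move=> nDx; rewrite /y !indicE (mem_set (A := ~` D) nDx) memNset ?mulr1 ?subr0//.
  by move/BD.
have ynB x : ~ B x -> `|y x| <= 1 - eta.
  move=> nBx; have [Dx|nDx] := pselect (D x).
    rewrite /y !indicE !memNset//.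
    by rewrite mulr0 subr0 normr0.
  by rewrite yD// normrM ger0_norm// ler_piMr// s1.
have y1 x : `|y x| <= 1.
  have [Bx|nBx] := pselect (B x); first by rewrite yB// normrN normr1.
  by rewrite (le_trans (ynB _ nBx))// gerBl ltW.
have eta01 : 0 < eta <= 1 by rewrite eta0.
have [z [B' [mz z1 [mB' B'0 B'B zB'] zZ]]] :=
  poor_flip poorZ mB B0 my eta01 ynB yB (divr_gt0 eps0 (ltr0n _ 2)).
have sb : ess_bounded mu s C by exact: ess_bounded_everywhere.
have zyle x : `|(z \- y) x| <= 2.
  by rewrite (le_trans (ler_normB _ _))// -[2]/(1 + 1 : R) lerD.
have zyb : ess_bounded mu (z \- y) 2.
  by apply: ess_bounded_everywhere => //; exact: measurable_funB.
exists (fun x => kappa * s x + (z \- y) x), (kappa * C + 2), B'; split.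
- by apply: measurable_funD; [exact: measurable_funM|exact: measurable_funB].
- move=> x; rewrite (le_trans (ler_normD _ _))// lerD//.
  by rewrite normrM ger0_norm// ler_wpM2l.
- by move=> x nDx; rewrite /= yD// addrC subrK.
- split => //; first exact: subset_trans B'B BD.
  move=> x B'x; have Bx := B'B _ B'x.
  rewrite /= (yB _ Bx) opprK.
  have := zB' _ B'x; have := ler_wpM2l kappa0 (sB _ Bx).
  have : n%:R - 2^-1 <= kappa * n%:R.
    rewrite /kappa mulrBl mul1r lerD2l lerN2 /eta invfM -mulrA.
    by rewrite ger_pMr// mulrC ler_pdivrMr// mul1r ler_nat.
  rewrite -natr1; lra.
- move=> F FZ; rewrite (pairing_linearl _ _ sb zyb).
  rewrite (le_trans (ler_normD _ _))// [eps]splitr [leRHS]mulrDl lerD ?zZ//.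
  by rewrite normrM ger0_norm// (le_trans _ (sZ _ FZ))// ler_piMl// gerBl ltW.
Qed.

End staircase.

(** * Essentially bounded classes with small action on a subspace *)

Section Linfty_bumps.
Context d (T : measurableType d) (R : realType).
Variable mu : {finite_measure set T -> \bar R}.
Implicit Types (G : Linfty mu).

Lemma Linfty_measurable G : measurable_fun setT (G : T -> R).
Proof. exact: (@measurable_funPT _ _ _ _ (Lrepr G)). Qed.

Lemma Linfty_normE G :
  (`|G|%:E = 'N[mu]_+oo[EFin \o (G : T -> R)])%E.
Proof.
rewrite (_ : `|G| = Lspace_norm G)//.
by rewrite (finite_norm_fine (Lrepr G)).
Qed.

(** When [mu] vanishes, the norm of [Linfty] is 0 by convention rather than an
    essential supremum. *)
Lemma ae_of_measureT0 (P : T -> Prop) : ~~ (0 < mu setT)%E ->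
  {ae mu, forall x, P x}.
Proof.
move=> muT; exists setT; split => //.
by apply/eqP; rewrite eq_le measure_ge0 andbT leNgt.
Qed.

Lemma Linfty_ae_le G : {ae mu, forall x, `|(G : T -> R) x| <= `|G|}.
Proof.
have [mu0|mu0] := boolP (0 < mu setT)%E; last exact: ae_of_measureT0.
have := ess_sup_ge mu (abse \o (EFin \o (G : T -> R))).
apply: filterS => x /=; rewrite -lee_fin Linfty_normE unlock /Lnorm mu0.
exact.
Qed.

Lemma Linfty_norm_le G (c : R) : 0 <= c ->
  {ae mu, forall x, `|(G : T -> R) x| <= c} -> `|G| <= c.
Proof.
move=> c0 Gc; rewrite -lee_fin Linfty_normE unlock /Lnorm.
case: ifPn => // mu0.
by apply/ess_supP; apply: filterS Gc => x /=; rewrite lee_fin.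
Qed.

Lemma Linfty_of_bounded (h : T -> R) (C : R) : measurable_fun setT h ->
  (forall x, `|h x| <= C) ->
  exists G, {ae mu, forall x, (G : T -> R) x = h x}.
Proof.
move=> mh hC.
have hL : h \in Lfun mu +oo.
  apply/andP; split; rewrite inE//= /finite_norm unlock /Lnorm.
  case: ifPn => // mu0; apply: (@le_lt_trans _ _ C%:E); last exact: ltry.
  by apply/ess_supP; apply: aeW => x /=; rewrite lee_fin.
exists (Lclass (Lfun_Sub (leey 1%E) hL)).
by apply: filterS (LclassK (Lfun_Sub (leey 1%E) hL)) => x /= ->.
Qed.

Lemma Linfty_ess_bounded G : ess_bounded mu (G : T -> R) `|G|.
Proof. by split; [exact: Linfty_measurable|exact: Linfty_ae_le]. Qed.

Variable Z : closedSubspace (L1 mu).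

Lemma dual_norm_le G (a : R) : 0 <= a ->
  (forall F, F \in Z -> `|pairing (G : T -> R) F| <= a * `|F|) ->
  dual_norm Z G <= a.
Proof.
move=> a0 Ga; apply: ge_sup.
  by exists `|pairing (G : T -> R) (0 : L1 mu)|, 0 => //=; rewrite rpred0 normr0.
by move=> _ [F [FZ F1] <-]; rewrite (le_trans (Ga _ FZ))// ler_piMr.
Qed.

Lemma pairing_le_dual_norm G (F : L1 mu) : F \in Z ->
  `|pairing (G : T -> R) F| <= dual_norm Z G * `|F|.
Proof.
move=> FZ; have Gb := Linfty_ess_bounded G.
have [->|F0] := eqVneq F 0; first by rewrite (pairing0r Gb) !normr0 mulr0.
have FN : 0 < `|F| by rewrite normr_gt0.
rewrite -ler_pdivrMr//; apply: ub_le_sup.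
  exists `|G| => _ [H [_ H1] <-].
  by rewrite (le_trans (pairing_le _ _ Gb))// ler_piMr.
exists (`|F|^-1 *: F) => /=.
  by rewrite rpredZ// normrZ normfV normr_id mulVf// gt_eqF.
rewrite -[LHS]/(`|pairing (G : T -> R) (`|F|^-1 *: F)|) (pairingZ _ _ Gb).
by rewrite normrM normfV normr_id mulrC.
Qed.

(** An everywhere defined form of a class of norm 1 in [Linfty], supported in
    [D] and of norm at most [eps] as a functional on [Z]. *)
Definition small_bump (D : set T) (eps : R) (g : T -> R) : Prop :=
  [/\ measurable_fun setT g, (forall x, `|g x| <= 1),
    (forall x, ~ D x -> g x = 0),
    (forall c, c < 1 -> (0 < mu [set x | (c < `|g x|)%R])%E)
    & forall F, F \in Z -> `|pairing g F| <= eps * `|F|].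

(** Truncating at 1 and cutting off outside [D] changes the representative
    only on a null set. *)
Lemma small_bump_of_Linfty (D : set T) (eps : R) G : measurable D ->
  `|G| = 1 -> {ae mu, forall x, ~ D x -> (G : T -> R) x = 0} ->
  dual_norm Z G < eps ->
  exists2 g, small_bump D eps g & {ae mu, forall x, g x = (G : T -> R) x}.
Proof.
move=> mD G1 GD Geps; have mG := Linfty_measurable G.
pose g x := Num.max (- 1) (Num.min 1 ((G : T -> R) x)) * \1_D x.
have mg : measurable_fun setT g.
  apply: measurable_funM => //.
  by apply: measurable_maxr => //; exact: measurable_minr.
have g1 x : `|g x| <= 1.
  rewrite normrM mulr_ile1//; last first.
    by rewrite indicE; case: (_ \in _); rewrite ?normr1 ?normr0.
  by rewrite ler_norml le_max lexx/= ge_max ge_min lexx/= andbT; lra.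
have gG : {ae mu, forall x, g x = (G : T -> R) x}.
  apply: filterS2 (Linfty_ae_le G) GD => x; rewrite G1 ler_norml => /andP[Gge Gle] GDx.
  rewrite /g indicE; have [xD|xD] := boolP (x \in D).
    by rewrite mulr1 (min_idPr Gle); apply/max_idPr.
  by rewrite mulr0 GDx// => Dx; move: xD; rewrite mem_set.
exists g => //; split => //.
- by move=> x nDx; rewrite /g indicE memNset// mulr0.
- move=> c c1.
  have mabsg : measurable_fun setT (fun x => `|g x|) by exact: measurableT_comp.
  have [//|nc] := measure_gt0_or_ae mu (measurable_gt c mabsg).
  have : `|G| <= Num.max c 0.
    apply: Linfty_norm_le; first by rewrite le_max lexx orbT.
    apply: filterS2 nc gG => x /= /negP; rewrite -leNgt => + <- => /le_trans; apply.
    by rewrite le_max lexx.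
  by rewrite G1 leNgt gt_max c1 ltr01.
- move=> F FZ; rewrite (pairing_ae F mg mG gG).
  by rewrite (le_trans (pairing_le_dual_norm G FZ))// ler_wpM2r// ltW.
Qed.

(** Dividing a function by its norm, which is at least [K], divides its action
    on [Z]. *)
Lemma Linfty_normalization (D B : set T) (h : T -> R) (C K a : R) :
  measurable_fun setT h -> (forall x, `|h x| <= C) ->
  (forall x, ~ D x -> h x = 0) -> measurable B -> (0 < mu B)%E ->
  0 < K -> (forall x, B x -> K <= `|h x|) ->
  (forall F, F \in Z -> `|pairing h F| <= a * `|F|) -> 0 <= a ->
  exists G : Linfty mu,
    [/\ `|G| = 1, {ae mu, forall x, ~ D x -> (G : T -> R) x = 0},
      dual_norm Z G <= a / K
      & (forall x, 0 <= h x) -> {ae mu, forall x, 0 <= (G : T -> R) x}].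
Proof.
move=> mh hC hD mB B0 K0 hB ha a0.
have [H Hh] := Linfty_of_bounded mh hC.
have HK : K <= `|H|.
  rewrite leNgt; apply/negP => HK.
  have : {ae mu, forall x, ~ B x}.
    apply: filterS2 Hh (Linfty_ae_le H) => x -> hx /hB.
    by rewrite leNgt (le_lt_trans hx).
  by move=> /(ae_not_measure0 mB) B0'; rewrite B0' ltxx in B0.
have H0 : 0 < `|H| by rewrite (lt_le_trans K0).
have GE := LscaleE `|H|^-1 H.
pose G : Linfty mu := `|H|^-1 *: H.
have GHh : {ae mu, forall x, (G : T -> R) x = `|H|^-1 * h x}.
  by apply: filterS2 GE Hh => x + <-.
have hb : ess_bounded mu h C by exact: ess_bounded_everywhere.
exists G; split.
- by rewrite normrZ normfV normr_id mulVf// gt_eqF.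
- by apply: filterS GHh => x -> /hD ->; rewrite mulr0.
- apply: dual_norm_le; first by rewrite divr_ge0// ltW.
  move=> F FZ; rewrite (pairing_ae F (Linfty_measurable G) _ GHh); last first.
    exact: measurable_funM.
  rewrite (pairingZl _ _ hb) normrM normfV normr_id mulrAC.
  rewrite mulrC ler_pM// ?invr_ge0//; first exact: ha.
  by rewrite lef_pV2.
- by move=> h0; apply: filterS GHh => x ->; rewrite mulr_ge0// invr_ge0.
Qed.

End Linfty_bumps.

(** * From signed to nonnegative functions *)

Section nonnegative.
Context d (T : measurableType d) (R : realType).
Variable mu : {finite_measure set T -> \bar R}.
Variable Z : closedSubspace (L1 mu).

Lemma small_bump_peak (D : set T) (eps : R) (g : T -> R) :
  small_bump Z D eps g ->
  exists g' : T -> R, small_bump Z D eps g' /\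
    (0 < mu [set x | (1 / 2 < g' x)%R])%E.
Proof.
move=> gb; have [mg g1 gD gc gZ] := gb.
have gc2 : (0 < mu [set x | (1 / 2 < `|g x|)%R])%E by apply: gc; lra.
have [gp|gn] := measure_gt0_or_ae mu (measurable_gt (1 / 2) mg).
  by exists g.
have mNg : measurable_fun setT (fun x => - g x) by exact: measurableT_comp.
have [gp|gn'] := measure_gt0_or_ae mu (measurable_gt (1 / 2) mNg).
  exists (fun x => - g x); split => //; split => //.
  - by move=> x; rewrite normrN.
  - by move=> x /gD ->; rewrite oppr0.
  - move=> c /gc; rewrite (_ : [set x | c < `|g x|] = [set x | c < `|- g x|])//.
    by apply/seteqP; split=> x /=; rewrite normrN.
  - move=> F FZ; rewrite (_ : (fun x => _) = fun x => -1 * g x); last first.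
      by apply/funext => x; rewrite mulN1r.
    rewrite (pairingZl _ _ (ess_bounded_everywhere mu mg g1)) mulN1r normrN.
    exact: gZ.
have m2 : measurable [set x | 1 / 2 < `|g x|].
  by apply: measurable_gt; exact: measurableT_comp.
suff /(ae_not_measure0 m2) g20 : {ae mu, forall x, ~ [set x | 1 / 2 < `|g x|] x}.
  by rewrite g20 ltxx in gc2.
apply: filterS2 gn gn' => x /= /negP + /negP; rewrite -!leNgt => gx gNx.
by apply/negP; rewrite -leNgt ler_norml gx lerNl gNx.
Qed.

(** Adding [t g], with [g] supported where [u >= t], keeps [u] nonnegative and
    raises its maximum by at least [t / 2 >= 1 / 2]. *)
Lemma nonnegative_growth (k : nat) (D : set T) (eps : R) :
  (forall D' e, measurable D' -> (0 < mu D')%E -> 0 < e ->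
    exists g, small_bump Z D' e g) ->
  measurable D -> (0 < mu D)%E -> 0 < eps ->
  exists (u : T -> R) (C : R) (B : set T),
    [/\ measurable_fun setT u, (forall x, `|u x| <= C) /\ (forall x, 0 <= u x),
      (forall x, ~ D x -> u x = 0),
      [/\ measurable B, (0 < mu B)%E, B `<=` D & forall x, B x -> 1 + k%:R / 2 <= u x]
      & forall F, F \in Z -> `|pairing u F| <= (1 + eps) * `|F|].
Proof.
move=> bumps mD D0; elim: k eps => [|k ih] eps eps0.
  exists \1_D, 1, D; split => //.
  - split=> x; rewrite ?indicE//; first by rewrite ger0_norm// ; case: (_ \in _).
  - by move=> x nDx; rewrite indicE memNset.
  - by split => // x Dx; rewrite indicE mem_set// mul0r addr0.
  - move=> F _; apply: pairing_le; first by rewrite addr_ge0// ltW.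
    apply: ess_bounded_everywhere => // x; rewrite indicE ger0_norm//.
    by case: (_ \in _); rewrite ?ler_wpDr// ?addr_ge0// ltW.
have eps2 : 0 < eps / 2 by rewrite divr_gt0.
have [u [C [B [meas_u [uC u0] uD [mB B0 BD uB] uZ]]]] := ih _ eps2.
pose t : R := 1 + k%:R / 2.
have t1 : 1 <= t by rewrite lerDl divr_ge0.
have t0 : 0 < t by exact: lt_le_trans t1.
have [g0 /small_bump_peak[g [[mg g1 gB _ gZ] gpos]]] :=
  bumps _ _ mB B0 (divr_gt0 eps2 t0).
have ub : ess_bounded mu u C by exact: ess_bounded_everywhere.
have gb : ess_bounded mu g 1 by exact: ess_bounded_everywhere.
have B'B : [set x | 1 / 2 < g x] `<=` B.
  move=> x /= gx; apply: contrapT => /gB gx0; move: gx; rewrite gx0.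
  by rewrite ltNge divr_ge0.
exists (fun x => t * g x + u x), (t + C), [set x | 1 / 2 < g x]; split.
- by apply: measurable_funD => //; exact: measurable_funM.
- split=> x.
    rewrite (le_trans (ler_normD _ _))// lerD// normrM gtr0_norm//.
    by rewrite ler_piMr// ltW.
  have [Bx|nBx] := pselect (B x); last by rewrite (gB _ nBx) mulr0 add0r.
  have := uB _ Bx; rewrite -/t => tu.
  have /ler_normlP[g1' _] := g1 x.
  rewrite -lerBlDr sub0r (le_trans _ (_ : - t <= _))//; first by rewrite lerN2.
  by rewrite -[leLHS]mulrN1 ler_pM2l// lerNl.
- by move=> x nDx; rewrite uD// addr0 gB ?mulr0// => /BD.
- split => //; first exact: measurable_gt.
    exact: subset_trans BD.
  move=> x /[dup] /B'B Bx /= gx; have := uB _ Bx; rewrite -/t => tu.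
  have tg : t * (1 / 2) <= t * g x by rewrite ler_pM2l// ltW.
  have -> : 1 + k.+1%:R / 2 = t + 1 / 2 :> R by rewrite -natr1 /t; field.
  rewrite addrC; apply: lerD => //; rewrite (le_trans _ tg)// ler_peMl//.
- move=> F FZ; rewrite (pairing_linearl _ _ gb ub).
  rewrite (le_trans (ler_normD _ _))// normrM (gtr0_norm t0).
  have -> : 1 + eps = t * (eps / 2 / t) + (1 + eps / 2).
    by rewrite mulrCA divff ?gt_eqF// mulr1 addrCA -splitr.
  by rewrite [leRHS]mulrDl lerD ?uZ// -mulrA ler_wpM2l ?gZ// ltW.
Qed.

End nonnegative.

(** * Small sets in a non-atomic measure space *)

Section nonatomic_measure.
Context d (T : measurableType d) (R : realType).
Variable mu : {finite_measure set T -> \bar R}.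

(** A countable union of null sets is null. *)
Lemma positive_measure_piece (A : set T) (F : nat -> set T) :
  measurable A -> (0 < mu A)%E -> (forall n, measurable (F n)) ->
  A `<=` \bigcup_n F n -> exists n, (0 < mu (A `&` F n))%E.
Proof.
move=> mA A0 mF AF; apply: contrapT => none.
suff : mu A = 0%E by move=> A0'; rewrite A0' ltxx in A0.
have negF n : mu.-negligible (A `&` F n).
  exists (A `&` F n); split => //; first exact: measurableI.
  apply/eqP; rewrite eq_le measure_ge0 andbT leNgt.
  by apply/negP => AFn; apply: none; exists n.
have [N [mN N0 AN]] := negligible_bigcup negF.
apply: (subset_measure0 mA mN _ N0) => x Ax.
by have [n _ Fnx] := AF _ Ax; apply: AN; exists n.
Qed.

(** Of two pieces of positive measure, one has at most half the measure. *)
Lemma nonatomic_halving (A : set T) (n : nat) : nonatomic mu ->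
  measurable A -> (0 < mu A)%E ->
  exists B, [/\ measurable B, B `<=` A, (0 < mu B)%E
    & fine (mu B) <= fine (mu A) / (2 ^ n)%:R].
Proof.
move=> na mA A0; elim: n => [|n [B [mB BA B0 muB]]].
  by exists A; split => //; rewrite divr1.
have [C [mC CB /andP[C0 CltB]]] := na _ mB B0.
have mBC : measurable (B `\` C) by exact: measurableD.
have muBC : fine (mu (B `\` C)) = fine (mu B) - fine (mu C).
  apply: EFin_inj; rewrite EFinB !fineK ?fin_num_measure// measureD//.
    by rewrite (setIidr CB).
  by rewrite ltey_eq fin_num_measure.
have half : fine (mu B) / 2 <= fine (mu A) / (2 ^ n.+1)%:R.
  by rewrite expnS natrM invfM mulrCA [leLHS]mulrC ler_wpM2l.
have [Chalf|Chalf] := leP (fine (mu C)) (fine (mu B) / 2).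
  exists C; split => //; first exact: subset_trans BA.
  exact: le_trans half.
exists (B `\` C); split => //.
- by apply: subset_trans BA; exact: subDsetl.
- rewrite -(fineK (fin_num_measure mu _ mBC)) lte_fin muBC subr_gt0.
  by apply: fine_lt; rewrite ?fin_num_measure.
- by rewrite (le_trans _ half)// muBC; lra.
Qed.

Lemma nonatomic_small_subset (A : set T) (e : R) : nonatomic mu ->
  measurable A -> (0 < mu A)%E -> 0 < e ->
  exists B, [/\ measurable B, B `<=` A, (0 < mu B)%E & fine (mu B) <= e].
Proof.
move=> na mA A0 e0; pose n := Num.bound (fine (mu A) / e).
have [B [mB BA B0 muB]] := nonatomic_halving n na mA A0.
exists B; split => //; rewrite (le_trans muB)//.
rewrite ler_pdivrMr ?ltr0n ?expn_gt0// mulrC -ler_pdivrMr//.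
have : fine (mu A) / e < n%:R.
  by rewrite archi_boundP// divr_ge0 ?fine_ge0// ltW.
by move=> /ltW/le_trans; apply; rewrite ler_nat ltnW// ltn_expl.
Qed.

(** The slices of [h] of height [delta], and the sets where [|Y| < k], are
    countably many and cover the space. *)
Lemma nearly_constant_piece (A : set T) (h Y : T -> R) (delta : R) :
  nonatomic mu -> measurable A -> (0 < mu A)%E ->
  measurable_fun setT h -> (forall x, `|h x| <= 1) -> measurable_fun setT Y ->
  0 < delta ->
  exists (B : set T) (c K : R),
    [/\ measurable B, B `<=` A, (0 < mu B)%E,
      -1 <= c <= 1 /\ (forall x, B x -> c <= h x <= c + delta)
      & (forall x, B x -> `|Y x| <= K) /\ K * fine (mu B) <= delta].
Proof.
move=> na mA A0 mh h1 mY delta0.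
have hp x : 0 <= h x + 1 by have := h1 x; rewrite ler_norml => /andP[? _]; lra.
pose H n := [set x | n%:R * delta <= h x + 1] `&` [set x | h x + 1 < n.+1%:R * delta].
have mh1 : measurable_fun setT (fun x => h x + 1) by exact: measurable_funD.
have mle (f : T -> R) (r : R) : measurable_fun setT f -> measurable [set x | r <= f x].
  move=> mf; rewrite (_ : [set _ | _] = f @^-1` `[r, +oo[).
    by rewrite -[X in measurable X]setTI; exact: mf.
  by apply/seteqP; split=> x /=; rewrite in_itv/= andbT.
have mlt (f : T -> R) (r : R) : measurable_fun setT f -> measurable [set x | f x < r].
  move=> mf; rewrite (_ : [set _ | _] = f @^-1` `]-oo, r[).
    by rewrite -[X in measurable X]setTI; exact: mf.
  by apply/seteqP; split=> x /=; rewrite in_itv.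
have mH n : measurable (H n) by apply: measurableI; [exact: mle|exact: mlt].
have AH : A `<=` \bigcup_n H n.
  move=> x _; have hd : 0 <= (h x + 1) / delta by rewrite divr_ge0// ltW.
  exists (Num.truncn ((h x + 1) / delta)) => //.
  have /andP[] := truncn_itv hd.
  by rewrite ler_pdivlMr// ltr_pdivrMr.
have [n An] := positive_measure_piece mA A0 mH AH.
have mAn : measurable (A `&` H n) by exact: measurableI.
pose G k := [set x | `|Y x| < k.+1%:R].
have mG k : measurable (G k) by apply: mlt; exact: measurableT_comp.
have AG : A `&` H n `<=` \bigcup_k G k.
  move=> x _; exists (Num.truncn `|Y x|) => //.
  by have /andP[] := truncn_itv (normr_ge0 (Y x)).
have [k Ank] := positive_measure_piece mAn An mG AG.
have mAnk : measurable (A `&` H n `&` G k) by exact: measurableI.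
have [B [mB BA B0 muB]] :=
  nonatomic_small_subset na mAnk Ank (divr_gt0 delta0 (ltr0Sn R k)).
have Bne : exists x, B x.
  apply: contrapT => Bne; suff BE : B = set0 by rewrite BE measure0 ltxx in B0.
  by apply/seteqP; split=> // x Bx; apply: Bne; exists x.
have Bh x : B x -> n%:R * delta - 1 <= h x <= n%:R * delta - 1 + delta.
  by move=> /BA[[_ []]] /=; rewrite -natr1 => ? ? _; apply/andP; split; lra.
exists B, (n%:R * delta - 1), k.+1%:R; split => //.
- by move=> x /BA[[]].
- split => //; have [x /Bh /andP[cx _]] := Bne.
  have := h1 x; rewrite ler_norml => /andP[_ hx1].
  have := mulr_ge0 (ler0n R n) (ltW delta0) => nd.
  by apply/andP; split; lra.
- split; first by move=> x /BA[_]/= /ltW.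
  by rewrite mulrC -ler_pdivlMr.
Qed.

End nonatomic_measure.

(** * Perturbing a norming function *)

(** [kx], [kY] and [kz] stand for the integrals of the perturbed function [k]
    against the new vector, the given one, and an element of the subspace, and
    [w] for the norm of a representative. *)
Lemma perturbation_estimate (R : realFieldType)
    (delta N alpha kx kY kz y z w : R) :
  0 < delta -> delta <= 1 / 2 -> delta <= N -> N - delta <= alpha ->
  1 - 2 * delta <= kx -> 1 - 2 * delta <= kY -> kz <= 2 * delta * z ->
  z <= 1 + N * y + w -> kx + alpha * kY - kz <= (1 + delta) * w ->
  (1 - 2 * delta) + (N - delta) * (1 - 2 * delta) - 2 * delta * (1 + N * y) <=
  (1 + 3 * delta) * w.
Proof.
move=> d0 d2 dN aN kx1 kY1 kz1 z1 kw.
have : (N - delta) * (1 - 2 * delta) <= alpha * kY by rewrite ler_pM//; lra.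
have : 2 * delta * z <= 2 * delta * (1 + N * y + w).
  by rewrite ler_pM2l// mulr_gt0.
lra.
Qed.

Section Daugavet_from_bumps.
Context d (T : measurableType d) (R : realType).
Variable mu : {finite_measure set T -> \bar R}.
Hypothesis mu_nonatomic : nonatomic mu.
Variable Z : closedSubspace (L1 mu).
Hypothesis bumps : forall D e, measurable D -> (0 < mu D)%E -> 0 < e ->
  exists g, small_bump Z D e g /\ forall x, 0 <= g x.
Local Notation Q := (quotient_space Z).
Local Notation pi := (\pi_Q)%qT.

(** Absolute continuity of the integral of [F], in the only form needed: [F]
    is bounded on the support of [g]. *)
Lemma pairing_localized_le (g : T -> R) (D : set T) (F : L1 mu) (K : R) :
  measurable_fun setT g -> (forall x, `|g x| <= 1) -> measurable D ->
  (forall x, ~ D x -> g x = 0) -> (forall x, D x -> `|(F : T -> R) x| <= K) ->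
  `|pairing g F| <= K * fine (mu D).
Proof.
move=> mg g1 mD gD FK.
have intgF := ess_bounded_integrableM F (ess_bounded_everywhere mu mg g1).
rewrite (le_trans (le_normr_Rintegral _ _))//.
rewrite -Rintegral_cst// [leRHS]Rintegral_mkcond; apply: le_Rintegral => //.
- exact: integrable_norm.
- rewrite (_ : _ \o _ = (EFin \o cst K) \_ D); last first.
    by apply/funext => x /=; rewrite !patchE; case: ifP.
  by have /(integrable_mkcond _ mD) := finite_measure_integrable_cst mu K mD.
- move=> x _; rewrite patchE; case: ifPn => [/set_mem Dx|/negP nDx].
    rewrite normrM (le_trans _ (FK _ Dx))// ler_piMl//.
  by rewrite gD ?mul0r ?normr0// => Dx; apply: nDx; exact: mem_set.
Qed.

(** The function [k = h + (1 - c) g] nearly annihilates [Z], nearly norms [pi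
    Y], and is nearly 1 where [g] peaks; integrating it against an arbitrary
    representative [W] bounds the quotient norm from below. *)
Lemma bump_perturbation (f : Q -> R) (a : T -> R) (N : R) (Y : L1 mu) (delta : R) :
  scalar f -> measurable_fun setT a -> (forall x, `|a x| <= N) ->
  (forall F, f (pi F) = pairing a F) -> `|pi Y : Q| = 1 ->
  0 < delta -> delta <= 1 / 2 -> delta <= N ->
  (0 < mu [set x | (N - delta < a x)%R])%E ->
  exists2 q : Q, `|q| <= 1 &
    (1 - 2 * delta) + (N - delta) * (1 - 2 * delta) -
      2 * delta * (1 + N * `|Y|) <=
    (1 + 3 * delta) * `|q + f q *: (pi Y : Q)|.
Proof.
move=> flin ma aN fa Y1 delta0 delta2 deltaN D0.
have mD := measurable_gt (N - delta) ma.
have N0 : 0 <= N by lra.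
have ab := ess_bounded_everywhere mu ma aN.
have [psi [psilin psile psiY]] := norming_functional (pi Y : Q).
have psile1 q : `|psi q| <= 1 * `|q| by rewrite mul1r.
have [h [mh h1 psih]] := quotient_functional_representation ler01 psilin psile1.
have hY : pairing h Y = 1 by rewrite -psih psiY.
have hb := ess_bounded_everywhere mu mh h1.
have [D [c [K [mE ED E0 [/andP[c1 c2] hc] [YK muK]]]]] :=
  nearly_constant_piece mu_nonatomic mD D0 mh h1 (L1_measurable Y) delta0.
have [g [[mg g1 gD gpeak gZ] g0]] := bumps mE E0 delta0.
have gb := ess_bounded_everywhere mu mg g1.
pose B := [set x | 1 - delta < g x].
have mB : measurable B by exact: measurable_gt.
have B0 : (0 < mu B)%E.
  have := gpeak (1 - delta); rewrite (_ : [set x | _] = B); last first.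
    by apply/seteqP; split=> x /=; rewrite ger0_norm.
  by apply; lra.
have BD x : B x -> D x.
  by move=> Bx; apply: contrapT => /gD gx; move: Bx; rewrite /B/= gx; lra.
pose k x := (1 - c) * g x + h x.
have mk : measurable_fun setT k.
  by apply: measurable_funD => //; exact: measurable_funM.
have cc0 : 0 <= 1 - c by rewrite subr_ge0.
have kle x : `|k x| <= 1 + delta.
  have := h1 x; rewrite !ler_norml => /andP[hx1 hx2].
  have gx0 := g0 x; have gx1 : g x <= 1 by rewrite -(ger0_norm gx0).
  have cg0 : 0 <= (1 - c) * g x by rewrite mulr_ge0.
  have [Dx|nDx] := pselect (D x); last first.
    by rewrite /k gD// mulr0 add0r; apply/andP; split; lra.
  have cg1 : (1 - c) * g x <= 1 - c by rewrite ler_piMr.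
  by have /andP[hcx hcx'] := hc _ Dx; rewrite /k; apply/andP; split; lra.
have kB x : B x -> 1 - 2 * delta <= k x.
  move=> Bx; have /andP[hcx _] := hc _ (BD _ Bx).
  have : (1 - c) * (1 - delta) <= (1 - c) * g x by rewrite ler_wpM2l// ltW.
  have : (1 - c) * delta <= 2 * delta by rewrite ler_wpM2r//; lra.
  by rewrite /k; lra.
have kb := ess_bounded_everywhere mu mk kle.
pose x0 := avgL1 mu B; pose q : Q := pi x0; pose alpha := f q.
have x01 : `|x0| = 1 by exact: avgL1_norm.
have kx0 : 1 - 2 * delta <= pairing k x0 by exact: pairing_avgL1_ge mB B0 mk kle kB.
have alphaE : alpha = pairing a x0 by rewrite /alpha fa.
have alpha1 : N - delta <= alpha.
  rewrite alphaE; apply: (pairing_avgL1_ge mB B0 ma aN).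
  by move=> x /BD /ED /= /ltW.
have alpha2 : alpha <= N.
  rewrite alphaE (le_trans (ler_norm _))// (le_trans (pairing_le _ N0 ab))//.
  by rewrite x01 mulr1.
have kY : 1 - 2 * delta <= pairing k Y.
  rewrite (pairing_linearl _ _ gb hb) hY.
  have /ler_normlP[gY _] := le_trans (pairing_localized_le mg g1 mE gD YK) muK.
  have : (1 - c) * (- pairing g Y) <= (1 - c) * delta by rewrite ler_wpM2l.
  have : (1 - c) * delta <= 2 * delta by rewrite ler_wpM2r//; lra.
  move: (pairing g Y) => r; lra.
have kZ F : F \in Z -> `|pairing k F| <= 2 * delta * `|F|.
  move=> FZ; rewrite (pairing_linearl _ _ gb hb) -psih quotient_pi_eq0//.
  rewrite (functional0 psilin) addr0 normrM (ger0_norm cc0) -mulrA ler_pM ?gZ//.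
  by lra.
exists q; first by rewrite (le_trans (quotient_pi_le _ _))// x01.
have rep W : pi W = q + alpha *: (pi Y : Q) ->
    (1 - 2 * delta) + (N - delta) * (1 - 2 * delta) -
      2 * delta * (1 + N * `|Y|) <= (1 + 3 * delta) * `|W|.
  move=> WE; pose z := x0 + alpha *: Y - W.
  have zZ : z \in Z.
    by rewrite /z; apply/quotient_eqP; rewrite quotient_piD (quotient_piZ Z alpha) WE.
  have zle : `|z| <= 1 + N * `|Y| + `|W|.
    rewrite (le_trans (ler_normB _ _))// lerD2r (le_trans (ler_normD _ _))//.
    rewrite x01 lerD2l normrZ ler_wpM2r// ger0_norm//.
    by rewrite (le_trans _ alpha1)// subr_ge0.
  have d1 : 0 <= 1 + delta by rewrite addr_ge0// ltW.
  have /ler_normlP[_ kWle] := pairing_le W d1 kb.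
  have kWE : pairing k W = pairing k x0 + alpha * pairing k Y - pairing k z.
    rewrite /z (pairingB _ _ kb) (pairingD _ _ kb) (pairingZ alpha Y kb).
    by rewrite opprB addrC subrK.
  have /ler_normlP[_ kz] := kZ _ zZ.
  rewrite kWE in kWle.
  exact: (perturbation_estimate delta0 delta2 deltaN alpha1 kx0 kY kz zle kWle).
apply/ler_addgt0Pr => e e0; have d3 : 0 < 1 + 3 * delta by rewrite addr_gt0// mulr_gt0.
have [W WE Wle] := quotient_repr_norm (q + alpha *: (pi Y : Q)) (divr_gt0 e0 d3).
rewrite (le_trans (rep _ WE))// -ler_pdivlMl// mulrDr mulKf ?gt_eqF// mulrC.
exact: ltW.
Qed.

End Daugavet_from_bumps.

(** * Characterization of poor subspaces *)

(** [8 + 5 N + 2 N y] collects the coefficients of [delta] in the estimate of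
    [bump_perturbation], after bounding [3 delta s] by [3 delta (1 + N)]. *)
Lemma almost_norming_estimate (R : realFieldType) (delta delta0 N y s : R) :
  0 < delta -> 0 <= N -> s <= 1 + N ->
  delta * (8 + 5 * N + 2 * (N * y)) <= delta0 ->
  (1 - 2 * delta) + (N - delta) * (1 - 2 * delta) - 2 * delta * (1 + N * y) <=
  (1 + 3 * delta) * s ->
  1 + N - delta0 <= s.
Proof.
move=> d0 N0 sN dd0.
have : delta * s <= delta * (1 + N) by rewrite ler_wpM2l// ltW.
have : 0 <= delta * delta by rewrite mulr_ge0// ltW.
lra.
Qed.

Section Daugavet_of_bumps.
Context d (T : measurableType d) (R : realType).
Variable mu : {finite_measure set T -> \bar R}.
Hypothesis mu_nonatomic : nonatomic mu.

(** The density [a] of [f] is close to [N] or to [- N] on a set of positive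
    measure; in the second case [(f, v)] is replaced by [(- f, - v)], which
    defines the same operator. *)
Lemma Daugavet_of_bumps (Z : closedSubspace (L1 mu)) :
  (forall D e, measurable D -> (0 < mu D)%E -> 0 < e ->
    exists g, small_bump Z D e g /\ forall x, 0 <= g x) ->
  Daugavet_property (quotient_space Z).
Proof.
move=> bumps; apply: Daugavet_of_almost_norming.
move=> f N v delta0 flin N0 fle fnorm v1 delta00.
have [a [ma aN fa]] := quotient_functional_representation (ltW N0) flin fle.
pose Y : L1 mu := repr v.
have YE : (\pi_(quotient_space Z) Y)%qT = v by rewrite reprK.
have C0 : 0 < 8 + 5 * N + 2 * (N * `|Y|).
  have NY : 0 <= N * `|Y| by rewrite mulr_ge0// ltW.
  by move: (N * `|Y|) NY => r r0; lra.
pose delta := Num.min (1 / 2) (Num.min N (delta0 / (8 + 5 * N + 2 * (N * `|Y|)))).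
have d0 : 0 < delta by rewrite !lt_min N0 !divr_gt0.
have d2 : delta <= 1 / 2 by rewrite ge_min lexx.
have dN : delta <= N by rewrite !ge_min lexx orbT.
have dC : delta * (8 + 5 * N + 2 * (N * `|Y|)) <= delta0.
  by rewrite -ler_pdivlMr// !ge_min lexx !orbT.
have sN q : `|q| <= 1 -> `|q + f q *: v| <= 1 + N.
  move=> q1; rewrite (le_trans (ler_normD _ _))// lerD// normrZ v1 mulr1.
  by rewrite (le_trans (fle q))// ler_piMr// ltW.
have [Dp|Dp] := measure_gt0_or_ae mu (measurable_gt (N - delta) ma).
  have [q q1 qle] :=
    bump_perturbation mu_nonatomic bumps flin ma aN fa
      (etrans (congr1 _ YE) v1) d0 d2 dN Dp.
  exists q => //; rewrite YE in qle.
  exact: almost_norming_estimate d0 (ltW N0) (sN _ q1) dC qle.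
have mNa : measurable_fun setT (fun x => - a x) by exact: measurableT_comp.
have [Dn|Dn] := measure_gt0_or_ae mu (measurable_gt (N - delta) mNa).
  have fNlin : scalar (fun q => - f q) by move=> b x y; rewrite flin; ring.
  have aNN x : `|- a x| <= N by rewrite normrN.
  have ab := ess_bounded_everywhere mu ma aN.
  have faN F : - f (\pi_(quotient_space Z) F)%qT = pairing (fun x => - a x) F.
    rewrite fa -mulN1r -(pairingZl _ _ ab); congr pairing.
    by apply/funext => x; rewrite mulN1r.
  have YNE : (\pi_(quotient_space Z) (- Y))%qT = - v.
    by rewrite -scaleN1r (quotient_piZ Z (-1)) YE scaleN1r.
  have vN1 : `|(\pi_(quotient_space Z) (- Y))%qT : quotient_space Z| = 1.
    by rewrite YNE normrN.
  have [q q1 qle] :=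
    bump_perturbation mu_nonatomic bumps fNlin mNa aNN faN vN1 d0 d2 dN Dn.
  exists q => //; rewrite YNE scalerN scaleNr opprK normrN in qle.
  exact: almost_norming_estimate d0 (ltW N0) (sN _ q1) dC qle.
have Nd : 0 <= N - delta by rewrite subr_ge0.
have ab : ess_bounded mu a (N - delta).
  split => //; apply: filterS2 Dp Dn => x /= /negP + /negP.
  by rewrite -!leNgt => ax aNx; rewrite ler_norml ax lerNl aNx.
have fle' F : `|f (\pi_(quotient_space Z) F)%qT| <= (N - delta) * `|F|.
  by rewrite fa pairing_le.
have [q q1 fq] := fnorm _ d0.
have := quotient_functional_le Nd fle' q => /(le_trans (ler_norm _)).
move=> /(lt_le_trans fq); rewrite ltNge ler_piMr//.
Qed.

End Daugavet_of_bumps.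

Section characterization.
Context d (T : measurableType d) (R : realType).
Variable mu : {finite_measure set T -> \bar R}.

(** The part [r] of the staircase function outside [D] is bounded by 1, so
    removing it changes the action on [Z] by at most 1, which is negligible
    against the height [n]. *)
Lemma poor_has_small_Linfty (Z : closedSubspace (L1 mu)) (D : set T) (eps : R) :
  poor Z -> measurable D -> (0 < mu D)%E -> 0 < eps ->
  exists g : Linfty mu,
    [/\ `|g| = 1, {ae mu, forall x, ~ D x -> (g : T -> R) x = 0}
      & dual_norm Z g < eps].
Proof.
move=> poorZ mD D0 eps0; pose n := (Num.bound (2 / eps)).+1.
have n0 : 0 < n%:R :> R by rewrite ltr0n.
have neps : 2 / n%:R < eps.
  rewrite ltr_pdivrMr// mulrC -ltr_pdivrMr//.
  rewrite (lt_trans (archi_boundP _))// ?ltr_nat//.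
  by rewrite divr_ge0// ltW.
have [s [C [B [ms sC s1 [mB B0 BD sB] sZ]]]] :=
  poor_staircase n poorZ mD D0 (ltr01 : 0 < 1 :> R).
have sb := ess_bounded_everywhere mu ms sC.
pose r x := s x * \1_(~` D) x.
have mr : measurable_fun setT r.
  by apply: measurable_funM => //; apply: measurable_indic; exact: measurableC.
have r1 x : `|r x| <= 1.
  rewrite /r indicE; have [xD|xD] := boolP (x \in ~` D).
    by rewrite mulr1 s1//; exact: set_mem.
  by rewrite mulr0 normr0.
have rb := ess_bounded_everywhere mu mr r1.
pose h x := -1 * r x + s x.
have mh : measurable_fun setT h.
  by apply: measurable_funD => //; exact: measurable_funM.
have hD x : ~ D x -> h x = 0.
  by move=> nDx; rewrite /h /r indicE mem_set// mulr1 mulN1r addNr.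
have hE x : D x -> h x = s x.
  by move=> Dx; rewrite /h /r indicE memNset ?mulr0 ?add0r// => /(_ Dx).
have hC x : `|h x| <= C.
  have [Dx|nDx] := pselect (D x); first by rewrite hE.
  by rewrite hD// normr0 (le_trans _ (sC x)).
have hB x : B x -> n%:R <= `|h x|.
  by move=> Bx; rewrite hE ?(le_trans (sB _ Bx)) ?ler_norm//; exact: BD.
have hZ F : F \in Z -> `|pairing h F| <= 2 * `|F|.
  move=> FZ; rewrite (pairing_linearl _ _ rb sb) mulN1r.
  rewrite (le_trans (ler_normD _ _))// normrN mulr_natl mulr2n -[X in _ <= X + X]mul1r.
  by rewrite lerD ?sZ// pairing_le.
have [G [G1 GD Gle _]] := Linfty_normalization mh hC hD mB B0 n0 hB hZ (ler0n _ 2).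
by exists G; split => //; exact: le_lt_trans neps.
Qed.

(** The functions of [nonnegative_growth] act on [Z] with norm at most 2 and
    are as large as desired. *)
Lemma nonnegative_small_Linfty (Z : closedSubspace (L1 mu)) (D : set T) (eps : R) :
  (forall D' e, measurable D' -> (0 < mu D')%E -> 0 < e ->
    exists g, small_bump Z D' e g) ->
  measurable D -> (0 < mu D)%E -> 0 < eps ->
  exists g : Linfty mu,
    [/\ `|g| = 1, {ae mu, forall x, ~ D x -> (g : T -> R) x = 0},
      {ae mu, forall x, 0 <= (g : T -> R) x} & dual_norm Z g < eps].
Proof.
move=> bumps mD D0 eps0; pose k := Num.bound (4 / eps).
have k0 : 0 < 1 + k%:R / 2 :> R by rewrite ltr_pwDl// divr_ge0.
have keps : (1 + 1) / (1 + k%:R / 2) < eps.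
  rewrite ltr_pdivrMr// mulrC -ltr_pdivrMr//.
  have : 4 / eps < k%:R by rewrite archi_boundP// divr_ge0// ltW.
  rewrite (_ : 4 / eps = 2 * ((1 + 1) / eps)); last by field; rewrite gt_eqF.
  by move: ((1 + 1) / eps) => r; lra.
have [u [C [B [meas_u [uC u0] uD [mB B0 BD uB] uZ]]]] :=
  nonnegative_growth k bumps mD D0 (ltr01 : 0 < 1 :> R).
have uB' x : B x -> 1 + k%:R / 2 <= `|u x|.
  by move=> Bx; rewrite (le_trans (uB _ Bx))// ler_norm.
have [G [G1 GD Gle Gge]] :=
  Linfty_normalization meas_u uC uD mB B0 k0 uB' uZ (addr_ge0 ler01 ler01).
by exists G; split => //; [exact: Gge|exact: le_lt_trans keps].
Qed.

(** Smallness on [Z] is inherited by every subspace of [Z]. *)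
Lemma poor_of_nonnegative_small (Z : closedSubspace (L1 mu)) : nonatomic mu ->
  (forall D eps, measurable D -> (0 < mu D)%E -> 0 < eps ->
    exists g : Linfty mu,
      [/\ `|g| = 1, {ae mu, forall x, ~ D x -> (g : T -> R) x = 0},
        {ae mu, forall x, 0 <= (g : T -> R) x} & dual_norm Z g < eps]) ->
  poor Z.
Proof.
move=> na small Z' Z'Z; apply: Daugavet_of_bumps => // D e mD D0 e0.
have [G [G1 GD G0 Ge]] := small _ _ mD D0 e0.
have [g [mg g1 gD gc gZ] gG] := small_bump_of_Linfty mD G1 GD Ge.
exists (fun x => `|g x|); split => //; split.
- exact: measurableT_comp.
- by move=> x; rewrite normr_id.
- by move=> x /gD ->; rewrite normr0.
- move=> c /gc; rewrite (_ : [set x | c < `|g x|] = [set x | c < `| `|g x| |])//.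
  by apply/seteqP; split=> x /=; rewrite normr_id.
- move=> F /Z'Z FZ; rewrite (pairing_ae (k := g)) ?gZ//.
    exact: measurableT_comp.
  by apply: filterS2 gG G0 => x -> Gx; rewrite ger0_norm.
Qed.

End characterization.

Unset Implicit Arguments.
Set Strict Implicit.

Theorem corollary6p6 (d : measure_display) (Omega : measurableType d)
    (R : realType) (mu : {finite_measure set Omega -> \bar R})
    (mu_nonatomic : nonatomic mu) (Z : closedSubspace (L1 mu)) :
  (poor Z <->
    forall (Delta : set Omega) (eps : R),
      measurable Delta -> (0 < mu Delta)%E -> 0 < eps ->
      exists g : Linfty mu,
        [/\ `|g| = 1,
            {ae mu, forall x, ~ Delta x -> (g : Omega -> R) x = 0}
          & dual_norm Z g < eps])
  /\
  (poor Z <->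
    forall (Delta : set Omega) (eps : R),
      measurable Delta -> (0 < mu Delta)%E -> 0 < eps ->
      exists g : Linfty mu,
        [/\ `|g| = 1,
            {ae mu, forall x, ~ Delta x -> (g : Omega -> R) x = 0},
            {ae mu, forall x, 0 <= (g : Omega -> R) x}
          & dual_norm Z g < eps]).
Proof.
pose small := forall (Delta : set Omega) (eps : R),
  measurable Delta -> (0 < mu Delta)%E -> 0 < eps ->
  exists g : Linfty mu,
    [/\ `|g| = 1, {ae mu, forall x, ~ Delta x -> (g : Omega -> R) x = 0}
      & dual_norm Z g < eps].
pose small_ge0 := forall (Delta : set Omega) (eps : R),
  measurable Delta -> (0 < mu Delta)%E -> 0 < eps ->
  exists g : Linfty mu,
    [/\ `|g| = 1, {ae mu, forall x, ~ Delta x -> (g : Omega -> R) x = 0},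
        {ae mu, forall x, 0 <= (g : Omega -> R) x} & dual_norm Z g < eps].
have poor_small : poor Z -> small by move=> poorZ D e; exact: poor_has_small_Linfty.
have small_small_ge0 : small -> small_ge0.
  move=> smallZ D eps; apply: nonnegative_small_Linfty => D' e mD' D'0 e0.
  have [G [G1 GD Ge]] := smallZ _ _ mD' D'0 e0.
  by have [g gb _] := small_bump_of_Linfty mD' G1 GD Ge; exists g.
have small_ge0_poor : small_ge0 -> poor Z by exact: poor_of_nonnegative_small.
split; split.
- exact: poor_small.
- by move=> /small_small_ge0.
- by move=> /poor_small/small_small_ge0.
- exact: small_ge0_poor.
Qed.
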